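(* Let $E$ be a real Banach space of dimension at least $2$ and let $D\subsetneq E$ be a $c$-uniform domain with $(r_1,r_2)$-HD boundary, where $0<r_1\le r_2<1$. Let $\varphi:[0,\infty)\to[0,\infty)$ be a homeomorphism with $\varphi(t)\ge t$ for all $t$. If $f$ is a $\varphi$-FQC map which maps $D$ onto itself with identity boundary values (that is, $f$ extends to a homeomorphism $\overline{D}\to\overline{D}$ whose restriction to $\partial D$ is the identity), then for all $x\in D$, $$k_D(x,f(x))\le C,$$ where $C$ is a constant depending only on $r_1$, $r_2$, $c$ and $\varphi$.
   Context: The norm of $E$ is $|\cdot|$. A domain is a nonempty open connected set. $\dot E=E\cup\{\infty\}$ is the Hausdorff space in which the neighborhoods of $\infty$ are the complements of closed bounded sets of $E$; boundaries $\partial A$ and closures $\overline{A}$ of sets $A\subset E$ are taken in $\dot E$, so $\infty\in\partial D$ when $D$ is unbounded. For a domain $D\subsetneq E$, $d_D(z)$ is the norm distance from $z\in D$ to $\partial D$, and $k_D(z_1,z_2)=\inf_\alpha\int_\alpha |dz|/d_D(z)$ is the quasihyperbolic distance, the infimum being over all rectifiable arcs $\alpha$ in $D$ joining $z_1$ to $z_2$. $D$ is $c$-uniform if each pair $z_1,z_2\in D$ can be joined by a rectifiable arc $\alpha$ in $D$ with $\min_{j=1,2}\ell(\alpha[z_j,z])\le c\,d_D(z)$ for all $z\in\alpha$ and $\ell(\alpha)\le c|z_1-z_2|$, where $\ell$ is norm length and $\alpha[z_j,z]$ is the part of $\alpha$ between $z_j$ and $z$. A homeomorphism $f:G\to G'$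 between domains is $\varphi$-solid if $k_{G'}(f(x),f(y))\le\varphi(k_G(x,y))$ for all $x,y\in G$ and $f^{-1}$ satisfies the analogous inequality. It is $\varphi$-FQC (freely $\varphi$-quasiconformal, fully $\varphi$-solid) if for every subdomain $G_1\subset G$ the map $f|_{G_1}:G_1\to f(G_1)$ is $\varphi$-solid. A metric space $X$ is $(r_1,r_2)$-HD (homogeneously dense), $0<r_1\le r_2<1$, if for each pair $a,b\in X$ there is $x\in X$ with $r_1|b-a|\le|x-a|\le r_2|b-a|$. HD spaces are understood to have no isolated points. For a boundary $\partial D\subset\dot E$, being $(r_1,r_2)$-HD means that the metric space $\partial D\cap E$ satisfies this condition and $\partial D$ has no isolated point in $\dot E$ (so $\partial D\cap E$ has more than one point, and is unbounded if $D$ is unbounded); for example $\partial(E\setminus\{0\})=\{0,\infty\}$ is not HD. *)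

(* Defs.v *)
From HB Require Import structures.
From mathcomp Require Import all_boot all_order all_algebra.
From mathcomp Require Import all_classical all_reals all_analysis.

Set Implicit Arguments.
Unset Strict Implicit.
Unset Printing Implicit Defensive.

Import Order.TTheory GRing.Theory Num.Theory.
Import numFieldNormedType.Exports.

Local Open Scope classical_set_scope.
Local Open Scope ring_scope.

(* The space E with a point at infinity [None]. This is not
   [one_point_compactification]: neighborhoods of infinity are (supersets of)
   complements of closed bounded sets, which need not be compact. *)
Definition extended_space (E : Type) : Type := option E.

Section extended_space_topology.
Context {R : realType} {E : normedModType R}.

Local Notation Edot := (extended_space E).

HB.instance Definition _ := Choice.on Edot.
HB.instance Definition _ := Pointed.on Edot.

Definition extended_nbhs (p : Edot) : set_system Edot :=
  if p is Some x then Some @ nbhs x else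
    filter_from (closed `&` bounded_set)
      (fun A => (Some @` (~` A)) `|` [set None]).

Let extended_filter (p : Edot) : ProperFilter (extended_nbhs p).
Proof.
case: p => [x|]; first exact: fmap_proper_filter.
apply: filter_from_proper; last by move=> ? _; exists None; right.
apply: filter_from_filter.
  exists set0; split; first exact: closed0.
  by rewrite /= /bounded_near; near=> M => x.
move=> P Q [cP bP] [cQ bQ]; exists (P `|` Q).
  split; first exact: closedU.
  move: bP bQ; rewrite /= /bounded_near => bP bQ.
  by apply: filterS2 bP bQ => M hP hQ x [/hP|/hQ].
case=> [x [|//]|[] //= _]; [|by split; right..].
by move=> [a /not_orP[Pa Qa]] [<-{x}]; split => //; left; exists a.
Unshelve. all: by end_near. Qed.

Let extended_singleton (p : Edot) U : extended_nbhs p U -> U p.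
Proof. by case: p => [x /= /nbhs_singleton//|[W _]]; apply; right. Qed.

Let extended_nbhs_nbhs (p : Edot) (A : set Edot) :
  extended_nbhs p A -> extended_nbhs p (extended_nbhs^~ A).
Proof.
case: p => [x /=|].
  rewrite nbhs_simpl nbhsE => -[U [oU Ux] USA/=].
  by exists U => //= z /=; rewrite nbhs_simpl nbhsE => Uz; exists U.
case=> C [cC bC] nCA /=; exists C => // -[|_]; last by exists C.
move=> x [|//] [y] /[swap] -[-> /=] nCx; rewrite nbhs_simpl nbhsE/=.
exists (~` C); first by split; first exact: closed_openC.
by move=> z /= nCz; apply: nCA; left; exists z.
Qed.

HB.instance Definition _ := hasNbhs.Build Edot extended_nbhs.

HB.instance Definition _ := @Nbhs_isNbhsTopological.Build Edot
  extended_filter extended_singleton extended_nbhs_nbhs.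

End extended_space_topology.

Definition homeomorphism_with (S T : topologicalType) (A : set S) (B : set T)
    (f : S -> T) (g : T -> S) : Prop :=
  [/\ {within A, continuous f}, {within B, continuous g},
      forall x, A x -> B (f x) /\ g (f x) = x &
      forall y, B y -> A (g y) /\ f (g y) = y].

Definition homeomorphism (S T : topologicalType) (A : set S) (B : set T)
    (f : S -> T) : Prop :=
  exists g, homeomorphism_with A B f g.

Section free_quasiconformality.
Context {R : realType} {E : normedModType R}.
Implicit Types (D G : set E) (x y z : E) (gamma : R -> E) (a b c r : R).

Definition dim_ge2 : Prop :=
  exists u v : E, forall a b, a *: u + b *: v = 0 -> a = 0 /\ b = 0.

Definition domain D : Prop := [/\ D !=set0, open D & connected D].

Definition ext_set D : set (extended_space E) := Some @` D.

Definition ext_closure D : set (extended_space E) := closure (ext_set D).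

Definition ext_boundary D : set (extended_space E) :=
  ext_closure D `\` interior (ext_set D).

Definition finite_boundary D : set E := Some @^-1` ext_boundary D.

(* Used only for [D <> setT], where [finite_boundary D] is nonempty. *)
Definition dist_boundary D z : R :=
  inf [set `|z - w| | w in finite_boundary D].

Definition curve_length gamma a b : \bar R :=
  ereal_sup [set (\sum_(0 <= i < size s)
      `|gamma (nth b (a :: s) i.+1) - gamma (nth b (a :: s) i)|)%:E
    | s in [set s : seq R | itv_partition a b s]].

(* An arc is a homeomorphic image of a compact interval; by compactness,
   continuity and injectivity suffice. The degenerate case [a = b] is a
   single point. *)
Definition rectifiable_arc D x y gamma a b : Prop :=
  [/\ a <= b, {within `[a, b], continuous gamma},
      {in `[a, b] &, injective gamma} & (curve_length gamma a b < +oo)%E] /\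
  [/\ gamma @` `[a, b] `<=` D, gamma a = x & gamma b = y].

(* The point of the arc at length [u] from its initial point, for
   [0 <= u <= curve_length gamma a b]. *)
Definition arclength_param gamma a b (u : R) : E :=
  gamma (xget a [set t | t \in `[a, b] /\ curve_length gamma a t = u%:E]).

Definition arc_integral (g : E -> R) gamma a b : \bar R :=
  (\int[lebesgue_measure]_(u in `[0%R, fine (curve_length gamma a b)])
     (g (arclength_param gamma a b u))%:E)%E.

Definition qh_dist D x y : \bar R :=
  ereal_inf [set k | exists gamma a b, rectifiable_arc D x y gamma a b /\
    k = arc_integral (fun z => (dist_boundary D z)^-1) gamma a b].

Definition uniform_domain c D : Prop :=
  domain D /\
  forall x y, D x -> D y -> exists gamma a b,
    [/\ rectifiable_arc D x y gamma a b,
        forall t, t \in `[a, b] ->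
          (Order.min (curve_length gamma a t) (curve_length gamma t b)
             <= (c * dist_boundary D (gamma t))%:E)%E &
        (curve_length gamma a b <= (c * `|x - y|)%:E)%E].

(* [qh_dist G x y] is finite for [x], [y] in a domain [G <> setT], so that
   [fine] only views it as a real number. *)
Definition qh_controlled (phi : R -> R) G G' (f : E -> E) : Prop :=
  forall x y, G x -> G y ->
    (qh_dist G' (f x) (f y) <= (phi (fine (qh_dist G x y)))%:E)%E.

Definition solid (phi : R -> R) G G' (f : E -> E) : Prop :=
  [/\ domain G, domain G' &
    exists g, [/\ homeomorphism_with G G' f g,
      qh_controlled phi G G' f & qh_controlled phi G' G g]].

Definition FQC (phi : R -> R) G G' (f : E -> E) : Prop :=
  [/\ domain G, domain G', homeomorphism G G' f &
    forall G1, domain G1 -> G1 `<=` G -> solid phi G1 (f @` G1) f].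

Definition HD r1 r2 (X : set E) : Prop :=
  forall a b : E, X a -> X b -> exists x, X x /\
    r1 * `|b - a| <= `|x - a| <= r2 * `|b - a|.

Definition HD_boundary r1 r2 D : Prop :=
  HD r1 r2 (finite_boundary D) /\ isolated (ext_boundary D) = set0.

Definition identity_boundary_values D (f : E -> E) : Prop :=
  exists F : extended_space E -> extended_space E,
    [/\ homeomorphism (ext_closure D) (ext_closure D) F,
        forall x, D x -> F (Some x) = Some (f x) &
        forall p, ext_boundary D p -> F p = p].

End free_quasiconformality.

Arguments dim_ge2 {R} E.

(* Main.v *)
(* Write d for the distance to the boundary, y = f(x), and k for k_D. Applied
   to a pair of points at distance at most d/2, the solidity of f and of its
   inverse g makes both maps coarsely Lipschitz in k, and this is all that is
   used of f besides its boundary values. Along a uniform arc from u one finds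
   chains of points with steps of size d/4 whose depths d grow geometrically
   (rays), so that points with |u - v| <= M min(d(u), d(v)) are joined by
   O(log M) such steps. Hence f maps a ray to a quasigeodesic chain, and a
   quasigeodesic chain of diameter r contains a point of depth comparable to r
   (the Morse-type argument of Gehring and Osgood).
   By homogeneous density there are finite boundary points a, b whose distances
   to x and to each other are comparable to d(x). Take rays from points u, v of
   D very close to a, b, with f(u), f(v) also close to a, b. If y is far from x,
   the image rays contain points w, w' of depth comparable to d(x) within
   C d(x) of a, b. The preimages of w, w' are at bounded k-distance, one lies
   on the ray of a, the other on the ray of b, so they are within bounded
   k-distance of x, and y is within bounded k-distance of w. Thus
   |x - f(x)| <= C d(x); the same bound for g gives |x - y| <= C d(y), and a
   uniform arc from x to y then shows that k(x, y) is bounded. *)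
Require Import Defs.
From mathcomp Require Import all_boot all_order all_algebra.
From mathcomp Require Import all_classical all_reals all_analysis.
From mathcomp Require Import ring lra zify.
Import Order.TTheory GRing.Theory Num.Theory.
Import numFieldNormedType.Exports.

Set Implicit Arguments.
Unset Strict Implicit.
Unset Printing Implicit Defensive.

Local Open Scope classical_set_scope.
Local Open Scope ring_scope.

(** * The boundary and the distance to it *)

Section boundary.
Context {R : realType} {E : normedModType R}.
Implicit Types (D : set E) (x y z v w : E).

Lemma nbhs_Some (x : E) (U : set (extended_space E)) :
  nbhs (Some x : extended_space E) U <-> nbhs x (Some @^-1` U).
Proof. by []. Qed.

Lemma finite_boundary_notin D w : open D -> finite_boundary D w -> ~ D w.
Proof.
move=> oD [_ nI] Dw; apply: nI; apply/nbhs_Some.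
by apply: filterS (open_nbhs_nbhs (conj oD Dw)) => z Dz /=; exists z.
Qed.

Lemma finite_boundaryP D w : closure D w -> ~ D w -> finite_boundary D w.
Proof.
move=> cw nDw; split.
  by move=> U /nbhs_Some /cw[z [Dz Uz]]; exists (Some z); split => //; exists z.
by move=> /interior_subset[z Dz [zw]]; apply: nDw; rewrite -zw.
Qed.

Lemma finite_boundary_closure D w : finite_boundary D w -> closure D w.
Proof.
move=> [cw _] U Uw.
have /cw[_ [[z Dz <-] [z' Uz' [zz']]]] :
    nbhs (Some w : extended_space E) (Some @` U).
  by apply/nbhs_Some; apply: filterS Uw => z Uz /=; exists z.
by exists z; split => //; rewrite -zz'.
Qed.

(** The first exit parameter works: its point is outside [D] because [D] is open, and it is a limit
    of points of [D] because all earlier parameters stay inside. *)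
Lemma segment_boundary D z v : open D -> D z -> ~ D v ->
  exists2 t : R, 0 <= t <= 1 & finite_boundary D (z + t *: (v - z)).
Proof.
move=> oD Dz nDv.
pose p (t : R) := z + t *: (v - z).
have cp : continuous p.
  by move=> t; apply: cvgD; [exact: cvg_cst|apply: cvgZr_tmp; exact: cvg_id].
pose S := [set t : R | 0 <= t /\ ~ D (p t)].
have S1 : S 1 by split; rewrite /p ?scale1r ?subrKC.
have S0 : lbound S 0 by move=> t [].
have iS : has_inf S by split; [exists 1|exists 0].
have t1 : inf S <= 1 by exact: (ge_inf (ex_intro _ 0 S0)).
have t0 : 0 <= inf S by apply: lb_le_inf => //; exists 1.
have nD : ~ D (p (inf S)).
  move=> Dp.
  have /nbhs_ballP[e /= e0 He] : nbhs (inf S) (p @^-1` D).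
    by apply: cp; exact: open_nbhs_nbhs.
  have [t /[dup] St [St0 nSt] tlt] := inf_adherent e0 iS.
  apply: nSt; apply: He; rewrite /ball /= ltr_distlC.
  by have := ge_inf (ex_intro _ 0 S0) St; lra.
exists (inf S); first by rewrite t0.
apply: finite_boundaryP => //.
move=> U /cp /nbhs_ballP[e /= e0 He].
have tpos : 0 < inf S.
  rewrite lt_neqAle t0 andbT eq_sym; apply/eqP => i0.
  by apply: nD; rewrite i0 /p scale0r addr0.
(* Clipping at 0 keeps [s] a parameter of the segment when [e] is large. *)
pose s := Num.max 0 (inf S - e / 2).
have s_lt : s < inf S by rewrite gt_max tpos /=; lra.
have s_ge : inf S - e / 2 <= s by rewrite le_max lexx orbT.
exists (p s); split.
  apply: contrapT => nDs.
  have Ss : S s by split => //; rewrite le_max lexx.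
  by have := ge_inf (ex_intro _ 0 S0) Ss; lra.
by apply: He; rewrite /ball /= ltr_distlC; lra.
Qed.

Section distance.
Variable D : set E.
Hypothesis oD : open D.
Local Notation d := (dist_boundary D).

Lemma dist_boundary_le z w : finite_boundary D w -> d z <= `|z - w|.
Proof. by move=> bw; apply: ge_inf; [exists 0 => _ [? _ <-] | exists w]. Qed.

Hypothesis nDT : D <> setT.

Lemma finite_boundary_neq0 z : D z -> finite_boundary D !=set0.
Proof.
move=> Dz; have [v nDv] : exists v, ~ D v.
  by apply/existsNP => DT; apply: nDT; apply/seteqP; split.
by have [t _ bt] := segment_boundary oD Dz nDv; exists (z + t *: (v - z)).
Qed.

Lemma dist_boundary_gt0 z : D z -> 0 < d z.
Proof.
move=> Dz; have /nbhs_ballP[e /= e0 He] := open_nbhs_nbhs (conj oD Dz).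
apply: lt_le_trans e0 _; apply: lb_le_inf.
  by have [w bw] := finite_boundary_neq0 Dz; exists `|z - w|, w.
move=> _ [w /(finite_boundary_notin oD) nDw <-]; rewrite leNgt; apply/negP.
by move=> zw; apply: nDw; apply: He; rewrite -ball_normE.
Qed.

(** Otherwise the segment from [z] to [v] would contain a boundary point at distance less than [d z]
    from [z]. *)
Lemma dist_boundary_ball z v : D z -> `|z - v| < d z -> D v.
Proof.
move=> Dz zv; apply: contrapT => nDv.
have [t /andP[t0 t1] bt] := segment_boundary oD Dz nDv.
have := dist_boundary_le z bt.
rewrite opprD addrA subrr add0r normrN normrZ ger0_norm// distrC leNgt.
by move/negP; apply; apply: le_lt_trans zv; rewrite ler_piMl.
Qed.

Lemma dist_boundary_lip z v : D z -> d v <= d z + `|z - v|.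
Proof.
move=> Dz; rewrite -lerBlDr; apply: lb_le_inf.
  by have [w bw] := finite_boundary_neq0 Dz; exists `|z - w|, w.
move=> _ [w bw <-]; have := dist_boundary_le v bw.
have := ler_distD z v w; rewrite (distrC v z); lra.
Qed.

Lemma near_boundary_point z e : D z -> 0 < e ->
  exists2 w, finite_boundary D w & `|z - w| < d z + e.
Proof.
move=> Dz e0.
have [|_ [w bw <-] we] := @inf_adherent _ [set `|z - w| | w in finite_boundary D] _ e0.
  split; last by exists 0 => _ [? _ <-].
  by have [w bw] := finite_boundary_neq0 Dz; exists `|z - w|, w.
by exists w.
Qed.

End distance.

(** An unbounded [D] has infinity on its boundary; if the finite boundary lay within radius [r], the
    complement of that ball would isolate infinity. *)
Lemma unbounded_boundary D (r : R) :
  isolated (ext_boundary D) = set0 -> open D ->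
  (forall r, exists2 z, D z & r < `|z|) ->
  exists2 w, finite_boundary D w & r < `|w|.
Proof.
move=> niso oD unb; apply: contrapT => nw.
have nbI s : nbhs (None : extended_space E)
    ((Some @` (~` [set z : E | `|z| <= s])) `|` [set None]).
  exists [set z : E | `|z| <= s] => //; split.
    apply: (@preimage_closed _ _ (@Num.norm _ E) [set t | t <= s]).
      by move=> z _; exact: norm_continuous.
    exact: closed_le.
  exists s; split; [exact: num_real|move=> t st z /= zs].
  exact: ltW (le_lt_trans zs st).
have bI : ext_boundary D None.
  split; last by move=> /interior_subset[].
  move=> U [A [_ [M [Mr bA]]] AU].
  have [z Dz zM] := unb (M + 1).
  exists (Some z); split; first by exists z.
  apply: AU; left; exists z => // Az.
  have M1 : M < M + 1 by lra.
  by have := bA _ M1 z Az; rewrite /= leNgt zM.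
have : isolated (ext_boundary D) None; last by rewrite niso.
split; first exact/mem_set.
exists ((Some @` (~` [set z : E | `|z| <= r])) `|` [set None]) => //.
apply/seteqP; split=> [p [[[w /negP]|//]]|p ->]; last by split => //; right.
by rewrite -ltNge => rw <- bw; case: nw; exists w.
Qed.
(** This is the form in which the boundary values of [f] enter: continuity of the extension at the
    fixed point [a], read off in [E]. *)
Lemma boundary_approach D (f : E -> E) a (e : R) : identity_boundary_values D f ->
  finite_boundary D a -> 0 < e ->
  exists u, [/\ D u, `|u - a| < e & `|f u - a| < e].
Proof.
move=> [F [[G [cF _ _ _]] Ff Fid]] ba e0.
have clA : ext_closure D (Some a) by case: ba.
have Fa : F (Some a) = Some a by exact: Fid.
have nb : nbhs (Some a : extended_space E) (Some @` ball a e).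
  by apply/nbhs_Some; apply: filterS (nbhsx_ballx a e e0) => z ? /=; exists z.
move/subspace_continuousP : cF => /(_ _ clA).
rewrite /from_subspace Fa => /(_ _ nb) /=.
(* Neighborhoods of [Some a] within the closure unfold by conversion to neighborhoods of [a] in
   [E]. *)
move=> h; have ae : nbhs a [set z | ext_closure D (Some z) ->
  (Some @` ball a e) (F (Some z))] := h.
have [u [Du [Fu ua]]] :=
  finite_boundary_closure ba (filterI ae (nbhsx_ballx a e e0)).
have [|w aw fw] := Fu; first by apply: subset_closure; exists u.
exists u; split => //; first by move: ua; rewrite -ball_normE /= distrC.
by move: fw aw; rewrite Ff// => -[<-]; rewrite -ball_normE /= distrC.
Qed.

(** If [D] is unbounded, so is its finite boundary. If [D] is bounded, the ray from [a] through [x]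
    leaves [D] beyond [x], hence at least as far from [a] as [x] is. *)
Lemma far_boundary_point D a x : isolated (ext_boundary D) = set0 ->
  open D -> D x -> finite_boundary D a ->
  exists2 b, finite_boundary D b & dist_boundary D x <= `|b - a|.
Proof.
move=> niso oD Dx ba.
have xa : dist_boundary D x <= `|x - a| by exact: dist_boundary_le.
have a0 : 0 < `|x - a|.
  rewrite normr_gt0 subr_eq0; apply/eqP => xa0.
  by apply: (finite_boundary_notin oD ba); rewrite -xa0.
have [unb|] := pselect (forall r : R, exists2 z, D z & r < `|z|).
  have [w bw rw] := unbounded_boundary (`|x - a| + `|a|) niso oD unb.
  exists w => //; apply: le_trans xa _.
  by have := lerB_dist w a; lra.
move=> /existsNP[r bD].
(* The factor makes [|v - x|] equal to [|r| + |x| + |x - a|], which forces [|v| > r]. *)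
pose v := x + ((`|r| + `|x|) / `|x - a| + 1) *: (x - a).
have nDv : ~ D v.
  move=> Dv; apply: bD; exists v => //.
  have t0 : 0 <= (`|r| + `|x|) / `|x - a| by rewrite divr_ge0 ?addr_ge0.
  have nt : `|((`|r| + `|x|) / `|x - a| + 1) *: (x - a)| =
      `|r| + `|x| + `|x - a|.
    by rewrite normrZ ger0_norm ?addr_ge0// mulrDl divfK ?gt_eqF// mul1r.
  have := ler_normB v x; rewrite {1}/v addrAC subrr add0r nt.
  by have := ler_norm r; lra.
have [t /andP[t0 t1] bt] := segment_boundary oD Dx nDv.
exists (x + t *: (v - x)) => //; apply: le_trans xa _.
have -> : v - x = ((`|r| + `|x|) / `|x - a| + 1) *: (x - a).
  by rewrite /v addrAC subrr add0r.
rewrite scalerA addrAC.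
set s := t * _.
have s0 : 0 <= s by rewrite mulr_ge0 ?addr_ge0 ?divr_ge0 ?addr_ge0.
have -> : x - a + s *: (x - a) = (1 + s) *: (x - a) by rewrite scalerDl scale1r.
by rewrite normrZ ler_peMl// ger0_norm ?lerDl ?addr_ge0.
Qed.

End boundary.

(** * Lengths and quasihyperbolic distance *)

Section nonneg_integral.
Local Open Scope ereal_scope.
Import HBNNSimple.

(* No measurability is assumed: the integral of a nonnegative function is
   defined as a supremum over the simple functions below it. *)
Lemma nonneg_integral_mono d (T : measurableType d) (R : realType)
    (mu : {measure set T -> \bar R}) (A : set T) (f g : T -> \bar R) :
  (forall x, A x -> 0 <= f x) -> (forall x, A x -> f x <= g x) ->
  \int[mu]_(x in A) f x <= \int[mu]_(x in A) g x.
Proof.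
move=> f0 fg.
have g0 x : A x -> 0 <= g x by move=> Ax; exact: le_trans (f0 x Ax) (fg x Ax).
rewrite !ge0_integralE//; apply: ereal_sup_le => _ [h /= hf <-].
by exists h => // x; apply: le_trans (hf x) _; exact: lee_restrict.
Qed.

(** With [a] the depth of the initial point, this is the lower bound for the quasihyperbolic length
    of an arc of length [l]. *)
Lemma integral_inv_affine (R : realType) (a l : R) : (0 < a)%R -> (0 <= l)%R ->
  \int[lebesgue_measure]_(s in `[0%R, l]) ((a + s)^-1)%:E =
    (ln (a + l) - ln a)%:E.
Proof.
move=> a0; rewrite le_eqVlt => /predU1P[<-|l0].
  by rewrite set_itv1 integral_set1 addr0 subrr.
have as0 (s : R) : (0 <= s)%R -> (0 < a + s)%R by move=> s0; rewrite ltr_wpDr.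
have der (s : R) : (0 <= s)%R ->
    is_derive s (1%R : R) (fun s => ln (a + s)%R) (a + s)^-1%R.
  move=> s0; have h := is_derive1_ln (as0 s s0).
  rewrite -[X in is_derive _ _ _ X]mulr1.
  apply: (@is_derive1_comp _ (@ln R) (fun s => a + s)%R s _ _ h).
  by rewrite -[X in is_derive _ _ _ X]add0r; apply: is_deriveD.
have cont (s : R) : (0 <= s)%R -> ln (a + x)%R @[x --> s] --> ln (a + s)%R.
  move=> s0; apply: (@continuous_comp _ _ _ (fun s => a + s)%R (@ln R)).
    by apply: cvgD; [exact: cvg_cst|exact: cvg_id].
  exact: continuous_ln (as0 s s0).
rewrite (@continuous_FTC2 _ _ (fun s => ln (a + s)%R) 0%R l) ?addr0//.
- apply: continuous_in_subspaceT => s; rewrite inE /= in_itv /= => /andP[s0 _].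
  apply: cvgV; first by rewrite gt_eqF// as0.
  by apply: cvgD; [exact: cvg_cst|exact: cvg_id].
- split.
  + by move=> s; rewrite in_itv /= => /andP[/ltW /der s0 _]; exact: ex_derive.
  + apply: cvg_at_right_filter; exact: cont.
  + apply: cvg_at_left_filter; exact: cont (ltW l0).
- move=> s; rewrite in_itv /= => /andP[/ltW /der s0 _].
  by rewrite derive1E; exact: derive_val.
Qed.

End nonneg_integral.

Section curve_length.
Context {R : realType} {E : normedModType R}.
Implicit Types (gamma : R -> E) (a b t : R) (s : seq R).

Fixpoint polygon_length gamma a s : R :=
  if s is t :: s' then `|gamma t - gamma a| + polygon_length gamma t s' else 0.

Lemma polygon_lengthE gamma a b s :
  \sum_(0 <= i < size s)
    `|gamma (nth b (a :: s) i.+1) - gamma (nth b (a :: s) i)| =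
  polygon_length gamma a s.
Proof.
elim: s a => [|t s IHs] a; first by rewrite big_nil.
by rewrite /= big_nat_recl//= IHs.
Qed.

Lemma polygon_length_rcons gamma a t s :
  polygon_length gamma a (rcons s t) =
  polygon_length gamma a s + `|gamma t - gamma (last a s)|.
Proof. by elim: s a => [|u s IHs] a /=; rewrite ?addr0 ?add0r ?IHs ?addrA. Qed.

Local Open Scope ereal_scope.

Lemma polygon_length_le gamma a b s : itv_partition a b s ->
  (polygon_length gamma a s)%:E <= curve_length gamma a b.
Proof.
by move=> abs; apply: ereal_sup_ubound; exists s => //; rewrite polygon_lengthE.
Qed.

Lemma curve_length_le gamma a b (M : \bar R) :
  (forall s, itv_partition a b s -> (polygon_length gamma a s)%:E <= M) ->
  curve_length gamma a b <= M.
Proof.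
by move=> h; apply: ge_ereal_sup => _ [s /= abs <-]; rewrite polygon_lengthE h.
Qed.

Lemma dist_le_curve_length gamma a b : (a <= b)%R ->
  `|gamma b - gamma a|%:E <= curve_length gamma a b.
Proof.
rewrite le_eqVlt => /predU1P[<-|ab].
  rewrite subrr normr0; apply: (@polygon_length_le gamma a a [::]).
  by rewrite /itv_partition /= eqxx.
have := @polygon_length_le gamma a b [:: b] (itv_partition1 ab).
by rewrite /= addr0.
Qed.

Lemma curve_length_ge0 gamma a b : (a <= b)%R -> 0 <= curve_length gamma a b.
Proof. by move=> ab; apply: le_trans (dist_le_curve_length gamma ab). Qed.

(** Putting [t] in front of a partition of [[t, b]] gives a partition of [[a, b]]. *)
Lemma dist_add_curve_length gamma a t b : (a <= t)%R -> (t <= b)%R ->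
  `|gamma t - gamma a|%:E + curve_length gamma t b <= curve_length gamma a b.
Proof.
rewrite le_eqVlt => /predU1P[<-|ta] tb; first by rewrite subrr normr0 add0e.
rewrite addeC -leeBrDr//; apply: curve_length_le => s [ts lb].
rewrite leeBrDr// addeC -EFinD.
by apply: (@polygon_length_le gamma a b (t :: s)); split; rewrite /= ?ta.
Qed.

Lemma curve_length_add_dist gamma a t b : (a <= t)%R -> (t <= b)%R ->
  curve_length gamma a t + `|gamma b - gamma t|%:E <= curve_length gamma a b.
Proof.
move=> at_; rewrite le_eqVlt => /predU1P[->|tb].
  by rewrite subrr normr0 adde0.
rewrite -leeBrDr//; apply: curve_length_le => s [ts /eqP lt].
rewrite leeBrDr// -EFinD -{1}lt -polygon_length_rcons.
apply: polygon_length_le; split; last by rewrite last_rcons.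
by rewrite rcons_path ts lt.
Qed.

Lemma le_curve_length_right gamma a t b : (a <= t)%R -> (t <= b)%R ->
  curve_length gamma a t <= curve_length gamma a b.
Proof.
move=> at_ tb; apply: le_trans (curve_length_add_dist gamma at_ tb).
by rewrite leeDl.
Qed.

Lemma le_curve_length_left gamma a t b : (a <= t)%R -> (t <= b)%R ->
  curve_length gamma t b <= curve_length gamma a b.
Proof.
move=> at_ tb; apply: le_trans (dist_add_curve_length gamma at_ tb).
by rewrite leeDr.
Qed.

(** If no parameter has length exactly [u], [xget] returns the default [a], whose length is 0; the
    inequality holds in both cases. *)
Lemma arclength_paramP gamma a b u : (a <= b)%R -> (0 <= u)%R ->
  exists t, [/\ t \in `[a, b], arclength_param gamma a b u = gamma t &
    curve_length gamma a t <= u%:E].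
Proof.
move=> ab u0; rewrite /arclength_param; case: xgetP => [t _ [tab tu]|_].
  by exists t; rewrite tu.
exists a; split => //; first by rewrite in_itv /= lexx.
apply: curve_length_le => s /itv_partitionxx -> /=.
by rewrite lee_fin.
Qed.

Lemma arc_integral_le (g : E -> R) gamma a b K : (a <= b)%R ->
  curve_length gamma a b < +oo ->
  (forall t, t \in `[a, b] -> (0 <= g (gamma t) <= K)%R) ->
  arc_integral g gamma a b <= K%:E * curve_length gamma a b.
Proof.
move=> ab loo gK; have l0 := curve_length_ge0 gamma ab.
have lfin : curve_length gamma a b \is a fin_num by rewrite ge0_fin_numE.
have f0 : (0 <= fine (curve_length gamma a b))%R by exact: fine_ge0.
rewrite /arc_integral.
apply: (@le_trans _ _ (\int[lebesgue_measure]_(u in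
    `[0%R, fine (curve_length gamma a b)]) K%:E)).
  apply: nonneg_integral_mono => u /=; rewrite in_itv /= => /andP[u0 _];
    have [t [tab -> _]] := arclength_paramP gamma ab u0;
    by have /andP[? ?] := gK t tab; rewrite lee_fin.
rewrite integral_cst//= lebesgue_measure_itv /= lte_fin.
have K0 : (0 <= K)%R.
  have /gK/andP[g0 gaK] : a \in `[a, b] by rewrite in_itv /= lexx.
  exact: le_trans gaK.
case: ltP => _; last by rewrite mule0 mule_ge0.
by rewrite -EFinB subr0 fineK.
Qed.

End curve_length.

Section quasihyperbolic.
Context {R : realType} {E : normedModType R}.
Variable D : set E.
Hypotheses (oD : open D) (nDT : D <> setT).
Local Notation d := (dist_boundary D).
Implicit Types (x y z : E).

Lemma qh_dist_ge0 x y : (0 <= qh_dist D x y)%E.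
Proof.
apply: le_ereal_inf_tmp => _ [gamma [a [b [[[ab _ _ _] [sub _ _]] ->]]]].
apply: integral_ge0 => u /=; rewrite in_itv /= => /andP[u0 _].
have [t [tab -> _]] := arclength_paramP gamma ab u0.
by rewrite lee_fin invr_ge0 ltW// dist_boundary_gt0//; apply: sub; exists t.
Qed.

(** On the segment the depth is at least [d x / 2], so the integrand is at most [2 / d x] over a
    length of at most [d x / 2]. *)
Lemma qh_dist_segment x y : D x -> `|x - y| <= d x / 2 ->
  (qh_dist D x y <= 1%:E)%E.
Proof.
move=> Dx xy; have dx := dist_boundary_gt0 oD nDT Dx.
pose gamma t := x + t *: (y - x).
(* For [x = y] the interval must collapse to a point, since an arc is injective. *)
pose b : R := (x != y)%:R.
have b0 : 0 <= b by rewrite ler0n.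
have b1 : b <= 1 by rewrite lern1 leq_b1.
have gd t : t \in `[0, b] -> D (gamma t) /\ d x / 2 <= d (gamma t).
  rewrite in_itv /= => /andP[t0 tb].
  have tx : `|x - gamma t| <= d x / 2.
    rewrite /gamma opprD addrA subrr add0r normrN normrZ ger0_norm// distrC.
    by apply: le_trans xy; rewrite ler_piMl// (le_trans tb).
  have Dt : D (gamma t) by apply: (dist_boundary_ball oD Dx); lra.
  by split => //; have := dist_boundary_lip oD nDT x Dt; rewrite distrC; lra.
have lenle : (curve_length gamma 0 b <= `|x - y|%:E)%E.
  apply: curve_length_le => s [ps /eqP ls]; rewrite lee_fin.
  apply: (@le_trans _ _ ((b - 0) * `|x - y|)); last by rewrite ler_piMl// subr0.
  rewrite -[in b - 0]ls; elim: s 0 {ls} ps => [|t s IHs] u /=.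
    by rewrite subrr mul0r.
  move=> /andP[ut /IHs]; rewrite /gamma opprD addrACA subrr add0r -scalerBl.
  rewrite normrZ gtr0_norm ?subr_gt0// (distrC y x).
  rewrite [X in _ -> _ <= X](_ : _ = (t - u) * `|x - y| +
    (last t s - t) * `|x - y|); last by ring.
  by move=> h; rewrite lerD2l.
have arc : rectifiable_arc D x y gamma 0 b.
  split; split => //.
  - by apply: continuous_subspaceT => t; apply: cvgD;
      [exact: cvg_cst|apply: cvgZr_tmp; exact: cvg_id].
  - move=> t u; rewrite /b; have [_|xy0] := eqVneq x y.
      by rewrite !in_itv /= -!eq_le => /eqP <- /eqP <-.
    move=> _ _ /addrI /eqP; rewrite -subr_eq0 -scalerBl scaler_eq0 !subr_eq0.
    by rewrite (eq_sym y) (negbTE xy0) orbF => /eqP.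
  - exact: le_lt_trans lenle (ltry _).
  - by move=> _ [t /gd[? _] <-].
  - by rewrite /gamma scale0r addr0.
  - rewrite /gamma /b; have [<-|_] := eqVneq x y; first by rewrite subrr scaler0 addr0.
    by rewrite scale1r subrKC.
apply: (@le_trans _ _ (arc_integral (fun z => (d z)^-1) gamma 0 b)).
  by apply: ereal_inf_lbound; exists gamma, 0, b.
apply: (@le_trans _ _ ((2 / d x)%:E * curve_length gamma 0 b)%E).
  apply: arc_integral_le => //; first by case: arc => -[].
  move=> t /gd[Dt dt]; have dt0 := dist_boundary_gt0 oD nDT Dt.
  rewrite invr_ge0 ltW//= -[2 / _]invrK invf_div lef_pV2 ?posrE ?divr_gt0//.
apply: (@le_trans _ _ ((2 / d x)%:E * (`|x - y|)%:E)%E).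
  by apply: lee_wpmul2l => //; rewrite lee_fin divr_ge0// ltW.
by rewrite -EFinM lee_fin mulrAC ler_pdivrMr// mul1r; lra.
Qed.

(** At length [u] from [x] the depth is at most [d x + u], so an arc of length [l] has
    quasihyperbolic length at least [ln (1 + l / d x)]. *)
Lemma qh_dist_lt_dist x y (r : R) : D x -> (qh_dist D x y < r%:E)%E ->
  `|x - y| <= expR r * d x.
Proof.
move=> Dx /ereal_inf_lt[_ [gamma [a [b [arc ->]]]] lt_r].
have dx := dist_boundary_gt0 oD nDT Dx.
case: arc => -[ab _ _ loo] [sub ga gb].
have l0 := curve_length_ge0 gamma ab.
have lfin : curve_length gamma a b \is a fin_num by rewrite ge0_fin_numE.
set l := fine (curve_length gamma a b) in lt_r *.
have lE : curve_length gamma a b = l%:E by rewrite /l fineK.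
have l0' : 0 <= l by exact: fine_ge0.
have xyl : `|x - y| <= l.
  by rewrite -lee_fin -lE -ga -gb distrC dist_le_curve_length.
have : (ln (d x + l) - ln (d x) < r).
  rewrite -lte_fin -integral_inv_affine//; apply: le_lt_trans lt_r.
  apply: nonneg_integral_mono => u /=; rewrite in_itv /= => /andP[u0 _].
    by rewrite lee_fin invr_ge0 addr_ge0// ltW.
  have [t [tab -> tu]] := arclength_paramP gamma ab u0.
  have Dt : D (gamma t) by apply: sub; exists t.
  have dt0 := dist_boundary_gt0 oD nDT Dt.
  rewrite lee_fin lef_pV2 ?posrE ?ltr_wpDr//.
  apply: (le_trans (dist_boundary_lip oD nDT (gamma t) Dx)).
  rewrite lerD2l -lee_fin; apply: le_trans tu; rewrite -ga distrC.
  by apply: dist_le_curve_length; move: tab; rewrite in_itv => /andP[].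
rewrite ltrBlDr -[ln (d x + l) < _]ltr_expR expRD !lnK ?posrE ?ltr_wpDr//.
lra.
Qed.

End quasihyperbolic.

(** * Rays in uniform domains *)

Section ray_definition.
Context {R : realType} {E : normedModType R}.
Implicit Types (D : set E) (c : R) (u v m : E).

(** Least factor gained by arc length plus initial depth when the arc advances by a quarter of the
    depth, because the depth is at least this sum divided by [1 + 2 * c]. *)
Definition growth_rate c : R := 1 + (4 * (1 + 2 * c))^-1.

(** The factor [1 + 2 * c] turns growth of that sum into growth of the depth. The factors [4 / 3]
    and [growth_rate c] pay for the last step, where the depth may drop by a quarter and no growth
    is guaranteed. *)
Definition growth_const c : R := 4 / 3 * growth_rate c * (1 + 2 * c).

Definition small_step D u v : Prop :=
  [/\ D u, D v, `|u - v| <= dist_boundary D u / 2 &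
      `|u - v| <= dist_boundary D v / 2].

(* A discrete cigar with vertex [u]: the distance to the boundary grows
   geometrically along the chain. *)
Definition ray D c (S : R) u m (z : nat -> E) (n : nat) : Prop :=
  [/\ z 0%N = u, z n = m,
    forall i, (i <= n)%N -> [/\ D (z i),
      `|z i - u| <= 2 * (1 + c) * dist_boundary D (z i) & `|z i - u| <= S],
    forall i, (i < n)%N -> small_step D (z i) (z i.+1) &
    forall i j, (i <= j <= n)%N ->
      growth_rate c ^+ (j - i) * dist_boundary D (z i) <=
        growth_const c * dist_boundary D (z j)].

End ray_definition.

Lemma growth_rate_gt1 (R : realType) (c : R) : 1 <= c -> 1 < growth_rate c.
Proof. by move=> c1; rewrite /growth_rate ltrDl invr_gt0; lra. Qed.

Lemma growth_const_ge1 (R : realType) (c : R) : 1 <= c -> 1 <= growth_const c.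
Proof.
move=> c1; have q1 := growth_rate_gt1 c1; rewrite /growth_const.
by apply: mulr_ege1; [apply: mulr_ege1|]; lra.
Qed.

Lemma expr_unbounded (R : realType) (q y : R) : 1 < q -> exists k, y < q ^+ k.
Proof.
move=> q1; have lq : 0 < ln q by exact: ln_gt0.
have q0 : 0 < q by exact: lt_trans q1.
exists (Num.bound (`|y| / ln q)).+1.
apply: le_lt_trans (ler_norm y) _.
set k := Num.bound _.
have ky : `|y| < k%:R * ln q.
  by rewrite -ltr_pdivrMr// archi_boundP// divr_ge0// ltW.
rewrite exprS; have kq : q ^+ k = expR (k%:R * ln q).
  by rewrite mulrC expRM_natr lnK.
have := expR_ge1Dx (k%:R * ln q); rewrite -kq => h.
have : 0 < q ^+ k by rewrite exprn_gt0.
by move=> qk; apply: (@lt_trans _ _ (q ^+ k)); [lra|rewrite ltr_pMl].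
Qed.

(** * Greedy chains along one half of a uniform arc *)

Section greedy_chain.
Context {R : realType} {E : normedModType R}.
Variables (D : set E) (c : R) (gamma : R -> E) (lam : R -> R) (a T : R).
Hypotheses (oD : open D) (nDT : D <> setT) (c1 : 1 <= c) (aT : a <= T).
Local Notation d := (dist_boundary D).
Hypothesis gD : forall t, a <= t <= T -> D (gamma t).
Hypothesis gcont : {within `[a, T], continuous gamma}.
(** [lam] abstracts the arc length measured from the vertex [gamma a], so that one argument serves
    both halves of an arc. *)
Hypothesis lam0 : 0 <= lam a.
Hypothesis lamD : forall t t', a <= t -> t <= t' -> t' <= T ->
  lam t + `|gamma t' - gamma t| <= lam t'.
(** The end [T] is excluded: in the application it is a supremum, and the cigar bound is derived
    only before it. *)
Hypothesis lam_le : forall t, a <= t < T -> lam t <= c * d (gamma t).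

Let u := gamma a.
(** Comparable to the depth before [T] ([L_le], [d_le_L]), but monotone, and positive already at
    [a]. *)
Let L t := lam t + d u.
Let q := growth_rate c.

Let Du : D u. Proof. by apply: gD; rewrite lexx. Qed.
Let du : 0 < d u. Proof. exact: dist_boundary_gt0. Qed.

Let dist_lam t : a <= t <= T -> `|gamma t - u| <= lam t.
Proof.
move=> /andP[at_ tT]; have := lamD (lexx a) at_ tT.
by move: lam0; rewrite -/u; lra.
Qed.

Let L_le t : a <= t < T -> L t <= (1 + 2 * c) * d (gamma t).
Proof.
move=> /andP[at_ tT].
have atT : a <= t <= T by rewrite at_ ltW.
have := dist_boundary_lip oD nDT u (gD atT).
have := dist_lam atT; have := lam_le (introT andP (conj at_ tT)).
by rewrite /L; lra.
Qed.

Let d_le_L t : a <= t <= T -> d (gamma t) <= L t.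
Proof.
move=> atT; have := dist_boundary_lip oD nDT (gamma t) Du.
by have := dist_lam atT; rewrite /L distrC; lra.
Qed.

Let L_growth t t' : a <= t < T -> t <= t' <= T ->
  d (gamma t) / 4 <= `|gamma t' - gamma t| -> q * L t <= L t'.
Proof.
move=> /[dup] /L_le Lt /andP[at_ tT] /andP[tt' t'T] dt.
apply: (@le_trans _ _ (lam t + `|gamma t' - gamma t| + d u)); last first.
  by rewrite lerD2r lamD.
rewrite /q /growth_rate mulrDl mul1r {1}/L -addrA -[leRHS]addrA lerD2l addrC.
rewrite lerD2r; apply: le_trans dt; rewrite ler_pdivrMl; last by move: c1; lra.
have -> : 4 * (1 + 2 * c) * (d (gamma t) / 4) = (1 + 2 * c) * d (gamma t) by field.
exact: Lt.
Qed.

(* From [t] jump to a later time at distance exactly a quarter of the depth;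
   each jump multiplies [L] by at least [q], and [L T] bounds [L]. *)
Let greedy k t : a <= t < T -> L T < q ^+ k * L t ->
  exists (tau : nat -> R) n, [/\ tau 0%N = t, tau n.+1 = T,
    forall i, (i <= n)%N -> a <= tau i < T,
    forall i, (i <= n)%N -> `|gamma (tau i) - gamma (tau i.+1)| <= d (gamma (tau i)) / 4 &
    forall i, (i < n)%N -> q * L (tau i) <= L (tau i.+1)].
Proof.
(* In the base case [L T < L t] contradicts the monotonicity of [L]. *)
elim: k t => [|k IHk] t /[dup] atT /andP[at_ tT] LT.
  have := lamD at_ (ltW tT) (lexx T); have := normr_ge0 (gamma T - gamma t).
  by move: LT; rewrite expr0 mul1r /L; lra.
have last_step : `|gamma t - gamma T| <= d (gamma t) / 4 -> exists (tau : nat -> R) n,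
  [/\ tau 0%N = t, tau n.+1 = T,
    forall i, (i <= n)%N -> a <= tau i < T,
    forall i, (i <= n)%N -> `|gamma (tau i) - gamma (tau i.+1)| <= d (gamma (tau i)) / 4 &
    forall i, (i < n)%N -> q * L (tau i) <= L (tau i.+1)].
  move=> h; exists (fun i => if i is 0%N then t else T), 0%N.
  by split => // -[].
have [/last_step//|far] := leP `|gamma t - gamma T| (d (gamma t) / 4).
have dt : 0 < d (gamma t) by apply: dist_boundary_gt0 => //; apply: gD; rewrite at_ ltW.
have cn : {within `[t, T], continuous (fun s => `|gamma t - gamma s|)}.
  apply: (@continuous_subspaceW _ _ _ `[a, T]).
    by move=> x /=; rewrite !in_itv /= => /andP[tx ->]; rewrite (le_trans at_).
  move=> x.
  apply: (@continuous_comp (subspace `[a, T]) _ _ gamma (fun z => `|gamma t - z|)).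
    exact: gcont.
  by apply: cvg_norm; apply: cvgB; [exact: cvg_cst|exact: cvg_id].
have [|s] := IVT (v := d (gamma t) / 4) (ltW tT) cn.
  by rewrite subrr normr0 ge_min le_max (ltW far) orbT andbT divr_ge0// ltW.
rewrite in_itv /= => /andP[ts]; rewrite le_eqVlt => /predU1P[-> hT|sT hs].
  by apply: last_step; rewrite hT.
have Lgr : q * L t <= L s.
  by apply: L_growth; rewrite ?at_ ?ts ?(ltW sT)// distrC hs.
have [||tau [n [tau0 taun tauT tstep tgr]]] := IHk s.
- by rewrite sT (le_trans at_).
- apply: lt_le_trans LT _; rewrite exprSr -mulrA ler_pM2l// exprn_gt0//.
  by apply: lt_trans (growth_rate_gt1 c1).
exists (fun i => if i is i'.+1 then tau i' else t), n.+1; split => //.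
- by case=> [|i] /=; [rewrite at_|exact: tauT].
- by case=> [|i] /=; [rewrite tau0 hs|exact: tstep].
- by case=> [|i] /=; [rewrite tau0|exact: tgr].
Qed.

Lemma greedy_ray S : (forall t, a <= t <= T -> `|gamma t - gamma a| <= S) ->
  exists z n, ray D c S (gamma a) (gamma T) z n.
Proof.
move=> HS.
have q1 : 1 < q := growth_rate_gt1 c1.
have Q1 := growth_const_ge1 c1.
have c1' := c1.
move: aT; rewrite le_eqVlt => /predU1P[<-|altT].
  exists (fun=> gamma a), 0%N; split => // [i _|i j].
    rewrite subrr normr0; split; first exact: Du.
      by rewrite !mulr_ge0//; [lra|exact: ltW du].
    by rewrite -(normr0 E) -(subrr (gamma a)); apply: HS; rewrite lexx.
  rewrite leqn0 => /andP[ij /eqP j0]; move: ij; rewrite j0 leqn0 => /eqP ->.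
  by rewrite subnn expr0 ler_wpM2r// ltW.
have La : 0 < L a by rewrite ltr_wpDl.
have [k hk] := expr_unbounded (L T / L a) q1.
have [||tau [n [tau0 taun tauT tstep tgr]]] := @greedy k a.
- by rewrite lexx.
- by rewrite -ltr_pdivrMr.
have tauT' i : (i <= n.+1)%N -> a <= tau i <= T.
  rewrite leq_eqVlt => /predU1P[->|/tauT/andP[-> /ltW->]//].
  by rewrite taun lexx ltW.
have zD i : (i <= n.+1)%N -> D (gamma (tau i)) by move=> /tauT'; exact: gD.
have step_half i : (i <= n)%N -> 3 / 4 * d (gamma (tau i)) <= d (gamma (tau i.+1)).
  move=> ni; have := dist_boundary_lip oD nDT (gamma (tau i)) (zD i.+1 ni).
  by have := tstep i ni; rewrite distrC; lra.
have Lgrow i j : (i <= j <= n)%N -> q ^+ (j - i) * L (tau i) <= L (tau j).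
  elim: j => [|j IHj] /andP[ij jn].
    by move: ij; rewrite leqn0 => /eqP ->; rewrite expr0 mul1r.
  move: ij; rewrite leq_eqVlt => /predU1P[->|ij].
    by rewrite subnn expr0 mul1r.
  apply: le_trans (tgr j jn); rewrite subSn// exprS -mulrA ler_pM2l.
    by apply: IHj; apply/andP; split; [|exact: ltnW].
  exact: lt_trans q1.
have dgrow i j : (i <= j <= n)%N ->
    q ^+ (j - i) * d (gamma (tau i)) <= (1 + 2 * c) * d (gamma (tau j)).
  move=> /[dup] ijn /andP[ij jn].
  apply: le_trans (L_le (tauT j jn)); apply: le_trans (Lgrow i j ijn).
  rewrite ler_pM2l ?exprn_gt0//; last exact: lt_trans q1.
  by apply/d_le_L/tauT'; rewrite leqW// (leq_trans ij).
exists (fun i => gamma (tau i)), n.+1; split; rewrite ?tau0 ?taun//.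
- move=> i ni; split; [exact: zD| |exact/HS/tauT'].
  have di := dist_boundary_gt0 oD nDT (zD i ni).
  have cd : 0 <= c * d (gamma (tau i)) by rewrite mulr_ge0 ?(ltW di)//; lra.
  (* At the last point [gamma T] the bound is transferred from [tau n], which is at most a quarter
     of its depth away. *)
  move: ni; rewrite leq_eqVlt => /predU1P[iE|ni].
    have [[h1 h2] h3] := (tstep n (leqnn n), step_half n (leqnn n),
      le_trans (dist_lam (tauT' n (leqnSn n))) (lam_le (tauT n (leqnn n)))).
    move: di cd; rewrite iE => di cd.
    have := ler_distD (gamma (tau n)) (gamma (tau n.+1)) u.
    rewrite (distrC (gamma (tau n.+1)) (gamma (tau n))) /u => h4.
    have h5 : c * d (gamma (tau n)) <= c * (4 / 3 * d (gamma (tau n.+1))).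
      by rewrite ler_pM2l; lra.
    by move: h3; rewrite /u; lra.
  have := le_trans (dist_lam (tauT' i (ltnW ni))) (lam_le (tauT i ni)).
  by rewrite /u; lra.
- move=> i ni; split; [exact/zD/ltnW|exact: zD| |].
    have di := dist_boundary_gt0 oD nDT (zD i (ltnW ni)).
    by have := tstep i ni; lra.
  have di := dist_boundary_gt0 oD nDT (zD i (ltnW ni)).
  by have := tstep i ni; have := step_half i ni; lra.
(* For [j = n.+1] growth is known only up to [n]; the missing factors are those in
   [growth_const]. *)
- move=> i j /andP[ij]; rewrite leq_eqVlt => /predU1P[jE|jn]; last first.
    have dj := dist_boundary_gt0 oD nDT (zD j (ltnW jn)).
    apply: le_trans (dgrow i j (introT andP (conj ij jn))) _.
    rewrite ler_pM2r// /growth_const ler_peMl; [by []|lra|].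
    by rewrite -/q; lra.
  move: ij; rewrite jE leq_eqVlt => /predU1P[->|ij].
    by rewrite subnn expr0 ler_pM2r//; exact/dist_boundary_gt0/zD.
  rewrite subSn// exprS /growth_const -/q -mulrA.
  have := dgrow i n (introT andP (conj ij (leqnn n))).
  rewrite -(ler_pM2l (lt_trans ltr01 q1)) => /le_trans; apply.
  have qc : 0 <= 4 / 3 * (q * (1 + 2 * c)) by rewrite !mulr_ge0//; lra.
  have := ler_wpM2l qc (step_half n (leqnn n)).
  by lra.
Qed.

End greedy_chain.

Section uniform.
Context {R : realType} {E : normedModType R}.
Implicit Types (x y u v : E).

(** Allows [c] to be replaced by the maximum of 1 and [c]. *)
Lemma uniform_domain_weaken (c c' : R) (D : set E) : D <> setT -> c <= c' ->
  uniform_domain c D -> uniform_domain c' D.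
Proof.
move=> nDT cc' [domD uD]; split => // x y Dx Dy.
have [_ oD _] := domD.
have [gamma [a [b [arc cig len]]]] := uD x y Dx Dy.
exists gamma, a, b; split => //.
  move=> t tab; apply: le_trans (cig t tab) _; rewrite lee_fin ler_wpM2r//.
  by apply/ltW/dist_boundary_gt0 => //; case: arc => _ [sub _ _]; apply: sub; exists t.
by apply: le_trans len _; rewrite lee_fin ler_wpM2r.
Qed.

Variables (D : set E) (c : R).
Hypotheses (nDT : D <> setT) (c1 : 1 <= c) (uD : uniform_domain c D).
Local Notation d := (dist_boundary D).

Let oD : open D. Proof. by case: uD => -[]. Qed.

(** Let [m] be the smaller depth of the two ends. A point [z] of the uniform arc is within [c * d z]
    of one end, so [m <= (1 + c) * d z]; and the arc has length at most [c * M * m]. *)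
Lemma uniform_qh_dist x y (M : R) : D x -> D y ->
  `|x - y| <= M * d x -> `|x - y| <= M * d y ->
  (qh_dist D x y <= (c * (1 + c) * M)%:E)%E.
Proof.
move=> Dx Dy Mx My; have c1' := c1.
have [dx dy] := (dist_boundary_gt0 oD nDT Dx, dist_boundary_gt0 oD nDT Dy).
have [gamma [a [b [arc cig len]]]] := uD.2 x y Dx Dy.
apply: (@le_trans _ _ (arc_integral (fun z => (d z)^-1) gamma a b)).
  by apply: ereal_inf_lbound; exists gamma, a, b.
case: arc => -[ab _ _ loo] [sub ga gb].
pose m := Num.min (d x) (d y).
have m0 : 0 < m by rewrite lt_min dx.
apply: (@le_trans _ _ (((1 + c) / m)%:E * curve_length gamma a b)%E).
  apply: arc_integral_le => // t tab.
  have Dt : D (gamma t) by apply: sub; exists t.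
  have dt := dist_boundary_gt0 oD nDT Dt.
  rewrite invr_ge0 (ltW dt) /= -[(1 + c) / m]invrK invf_div lef_pV2 ?posrE//.
    2: by rewrite divr_gt0//; lra.
  rewrite ler_pdivrMr; last by lra.
  have /andP[at_ tb] : a <= t <= b by move: tab; rewrite in_itv.
  have := cig t tab; rewrite ge_min => /orP[] h.
    have : `|gamma t - x| <= c * d (gamma t).
      by rewrite -lee_fin; apply: le_trans h; rewrite -ga dist_le_curve_length.
    have := dist_boundary_lip oD nDT x Dt.
    have : m <= d x by rewrite ge_min lexx.
    by lra.
  have : `|gamma t - y| <= c * d (gamma t).
    by rewrite -lee_fin; apply: le_trans h; rewrite -gb distrC dist_le_curve_length.
  have := dist_boundary_lip oD nDT y Dt.
  have : m <= d y by rewrite ge_min lexx orbT.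
  by lra.
apply: (@le_trans _ _ (((1 + c) / m)%:E * (c * `|x - y|)%:E)%E).
  by apply: lee_wpmul2l len; rewrite lee_fin divr_ge0 ?(ltW m0)//; lra.
rewrite -EFinM lee_fin.
have Mm : `|x - y| <= M * m.
  by rewrite /m; case: (leP (d x) (d y)).
have -> : (1 + c) / m * (c * `|x - y|) = c * (1 + c) * (`|x - y| / m).
  by rewrite mulrACA (mulrC m^-1) (mulrC c).
by rewrite ler_wpM2l ?mulr_ge0//; [lra|lra|rewrite ler_pdivrMr].
Qed.

(** Time reversal, for the half of an arc that starts at [y]. *)
Lemma opp_within_continuous (gamma : R -> E) a b :
  {within `[a, b], continuous gamma} ->
  {within `[- b, - a], continuous (fun t => gamma (- t))}.
Proof.
move=> /subspace_continuousP cg; apply/subspace_continuousP => t tab.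
have tab' : `[a, b]%classic (- t).
  by move: tab; rewrite /= !in_itv /= => /andP[tb ta]; apply/andP; split; lra.
move=> U /(cg _ tab') h.
have {}h : nbhs (- t) [set s | `[a, b]%classic s -> U (gamma s)] := h.
suff : nbhs t [set r | `[- b, - a]%classic r -> U (gamma (- r))] by [].
have h' : nbhs t [set r | `[a, b]%classic (- r) -> U (gamma (- r))].
  exact: (@oppr_continuous R R t _ h).
move: h'; apply: filterS => r hr rab; apply: hr.
by move: rab; rewrite /= !in_itv /= => /andP[tb ta]; apply/andP; split; lra.
Qed.

(** The uniform arc is cut where its two parts balance in length; on each half the minimum in the
    cigar condition is the length from the nearer end, so [greedy_ray] applies to both halves. *)
Lemma uniform_rays x y : D x -> D y ->
  exists m z n z' n', ray D c (c * `|x - y|) x m z n /\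
    ray D c (c * `|x - y|) y m z' n'.
Proof.
move=> Dx Dy; have [gamma [a [b [arc cig len]]]] := uD.2 x y Dx Dy.
case: arc => -[ab cg _ loo] [sub ga gb].
pose lam t := curve_length gamma a t.
pose mu t := curve_length gamma t b.
have lfin t : a <= t <= b -> lam t \is a fin_num.
  move=> /andP[at_ tb]; rewrite ge0_fin_numE ?curve_length_ge0//.
  exact: le_lt_trans (le_curve_length_right gamma at_ tb) loo.
have mfin t : a <= t <= b -> mu t \is a fin_num.
  move=> /andP[at_ tb]; rewrite ge0_fin_numE ?curve_length_ge0//.
  exact: le_lt_trans (le_curve_length_left gamma at_ tb) loo.
pose S := [set t | a <= t <= b /\ (lam t <= mu t)%E].
have Sa : S a.
  split; first by rewrite lexx.
  apply: le_trans (curve_length_ge0 gamma ab).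
  by apply: curve_length_le => s /itv_partitionxx ->.
have ubS : ubound S b by move=> t [/andP[]].
have supS : has_sup S by split; [exists a|exists b].
pose T := sup S.
have aT : a <= T by apply: ub_le_sup => //; exists b.
have Tb : T <= b by apply: ge_sup => //; exists a.
have near t : a <= t <= b ->
    `|gamma t - x| <= c * `|x - y| /\ `|gamma t - y| <= c * `|x - y|.
  move=> /andP[at_ tb]; rewrite -!lee_fin; split; apply: le_trans len.
    rewrite -ga; apply: le_trans (le_curve_length_right gamma at_ tb).
    exact: dist_le_curve_length.
  rewrite -gb distrC; apply: le_trans (le_curve_length_left gamma at_ tb).
  exact: dist_le_curve_length.
(* Some [s > t] lies in [S], so [lam t <= lam s <= mu s <= mu t]: both terms of the minimum are at
   least [lam t]. *)
have before t : a <= t < T -> (lam t <= (c * d (gamma t))%:E)%E.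
  move=> /andP[at_ tT].
  have [s [/andP[as_ sb] ls] ts] := sup_gt (proj1 supS) tT.
  have tab : t \in `[a, b] by rewrite in_itv /= at_ (le_trans (ltW tT)).
  have := cig t tab; rewrite ge_min => /orP[//|]; apply: le_trans.
  apply: le_trans (le_curve_length_right gamma at_ (ltW ts)) _.
  exact: le_trans ls (le_curve_length_left gamma (ltW ts) sb).
have after t : T < t <= b -> (mu t <= (c * d (gamma t))%:E)%E.
  move=> /andP[tT tb].
  have tab : t \in `[a, b] by rewrite in_itv /= tb (le_trans aT (ltW tT)).
  have := cig t tab; rewrite ge_min => /orP[|//]; apply: le_trans.
  rewrite leNgt; apply/negP => /ltW lm.
  have : t <= T.
    apply: ub_le_sup; first by exists b.
    by split; rewrite // tb (le_trans aT (ltW tT)).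
  by rewrite leNgt tT.
have gD t : a <= t <= b -> D (gamma t).
  by move=> tab; apply: sub; exists t; rewrite //= in_itv.
have [z [n zn]] : exists z n, ray D c (c * `|x - y|) x (gamma T) z n.
  rewrite -ga; apply: (greedy_ray (lam := fun t => fine (lam t)) oD nDT c1 aT).
  - by move=> t /andP[at_ tT]; apply: gD; rewrite at_ (le_trans tT).
  - apply: continuous_subspaceW cg => t /=.
    by rewrite !in_itv /= => /andP[-> tT]; rewrite (le_trans tT).
  - by apply: fine_ge0; exact: curve_length_ge0.
  - move=> t t' at_ tt' t'T.
    have tb : t <= b by apply: le_trans Tb; exact: le_trans t'T.
    rewrite -lee_fin EFinD !fineK.
    + exact: curve_length_add_dist.
    + by apply: lfin; rewrite (le_trans at_ tt') (le_trans t'T).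
    + by apply: lfin; rewrite at_ tb.
  - move=> t /andP[at_ tT]; rewrite -lee_fin fineK; first by apply: before; rewrite at_.
    by apply: lfin; rewrite at_ (le_trans (ltW tT)).
  - by move=> t /andP[at_ tT]; rewrite ga; apply: (near t _).1; rewrite at_ (le_trans tT).
have [z' [n' zn']] : exists z n, ray D c (c * `|x - y|) y (gamma T) z n.
  have Tb' : - b <= - T by rewrite lerN2.
  rewrite -[T]opprK -gb -[b in gamma b]opprK.
  apply: (greedy_ray (lam := fun t => fine (mu (- t)))
    (gamma := fun t => gamma (- t)) oD nDT c1 Tb').
  - by move=> t /andP[at_ tT]; apply: gD; apply/andP; split; lra.
  - apply: opp_within_continuous; apply: continuous_subspaceW cg => t /=.
    by rewrite !in_itv /= => /andP[Tt ->]; rewrite (le_trans aT).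
  - by apply: fine_ge0; rewrite opprK; exact: curve_length_ge0.
  - move=> t t' at_ tt' t'T.
    have h1 : a <= - t' by lra.
    have h2 : - t' <= - t by lra.
    have h3 : - t <= b by lra.
    rewrite -lee_fin EFinD !fineK.
    + by rewrite addeC distrC; exact: dist_add_curve_length.
    + by apply: mfin; rewrite h1 (le_trans h2).
    + by apply: mfin; rewrite h3 (le_trans h1).
  - move=> t /andP[at_ tT]; rewrite -lee_fin fineK.
      by apply: after; apply/andP; split; lra.
    by apply: mfin; apply/andP; split; lra.
  - move=> t /andP[at_ tT]; rewrite opprK gb; apply: (near _ _).2.
    by apply/andP; split; lra.
by exists (gamma T), z, n, z', n'.
Qed.

End uniform.

(** * Distortion of small steps by solid maps *)

Section coarse.
Context {R : realType} {E : normedModType R}.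

Definition coarse_lipschitz (D : set E) (A : R) (f : E -> E) : Prop :=
  forall u v, small_step D u v ->
    `|f u - f v| <= A * dist_boundary D (f u) /\
    dist_boundary D (f v) <= A * dist_boundary D (f u).

(** The ends of a small step are at quasihyperbolic distance at most 1, so their images are at
    distance less than [A], and [qh_dist_lt_dist] applies. The summand 1 comes from the Lipschitz
    bound for the depth. *)
Lemma qh_controlled_coarse_lipschitz (D : set E) (phi : R -> R) (A : R) f :
  open D -> D <> setT -> (forall x, D x -> D (f x)) ->
  (forall t, 0 <= t <= 1 -> phi t < A) ->
  qh_controlled phi D D f -> coarse_lipschitz D (1 + expR A) f.
Proof.
move=> oD nDT fD phiA qc u v [Du Dv uv _].
have k1 := qh_dist_segment oD nDT Du uv.
have k0 := qh_dist_ge0 oD nDT u v.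
have kfin : qh_dist D u v \is a fin_num.
  by rewrite ge0_fin_numE//; apply: le_lt_trans k1 (ltry _).
have kA : (qh_dist D (f u) (f v) < A%:E)%E.
  apply: le_lt_trans (qc u v Du Dv) _; rewrite lte_fin phiA//.
  by rewrite fine_ge0//= -lee_fin fineK.
have fuv := qh_dist_lt_dist oD nDT (fD u Du) kA.
have dfu := dist_boundary_gt0 oD nDT (fD u Du).
have := dist_boundary_lip oD nDT (f v) (fD u Du).
by split; lra.
Qed.

End coarse.

(** * Quasigeodesic chains *)

Section quasigeodesic.
Context {R : realType} {E : normedModType R}.

(* Let [t] be the first index at which [delta] reaches [delta i / (2 A)]. Then
   [delta t] is the maximum over [j..t] and at most [delta i / 2], so induction
   gives a geometric series, while between [t] and [i] all depths are
   comparable and the number of steps is controlled by the distance. *)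
Lemma quasigeodesic_cigar (A B : R) (w : nat -> E) (delta : nat -> R) (n : nat) :
  1 <= A -> 0 <= B ->
  (forall i, (i <= n)%N -> 0 < delta i) ->
  (forall i, (i < n)%N -> `|w i - w i.+1| <= A * delta i) ->
  (forall i, (i < n)%N -> delta i.+1 <= A * delta i) ->
  (forall i j (M : R), (i <= j <= n)%N -> 0 <= M ->
    `|w i - w j| <= M * delta i -> `|w i - w j| <= M * delta j ->
    (j - i)%:R <= (4 * A ^+ 2)^-1 * M + B) ->
  forall i j, (j <= i <= n)%N ->
    (forall l, (j <= l <= i)%N -> delta l <= delta i) ->
    `|w j - w i| <= 4 * A * B * delta i.
Proof.
move=> A1 B0 delta0 wstep dstep qg.
have direct i j : (j <= i <= n)%N ->
    (forall l, (j <= l <= i)%N -> delta l <= delta i) ->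
    delta i <= 2 * A * delta j -> `|w j - w i| <= 2 * A * B * delta i.
  move=> /andP[ji ni] dmax dj.
  have path k : (j + k <= i)%N -> `|w j - w (j + k)%N| <= A * delta i * k%:R.
    elim: k => [|k IHk] jki; first by rewrite addn0 subrr normr0 mulr0.
    rewrite addnS in jki *.
    have := ler_distD (w (j + k)%N) (w j) (w (j + k).+1).
    have := IHk (ltnW jki); have := wstep _ (leq_trans jki ni).
    have : A * delta (j + k)%N <= A * delta i.
      by rewrite ler_wpM2l; [|lra|apply: dmax; rewrite leq_addr ltnW].
    by rewrite -natr1; lra.
  have m0 := delta0 i ni.
  have dj0 := delta0 j (leq_trans ji ni).
  pose X := `|w j - w i|.
  have := path (i - j)%N; rewrite subnKC// => /(_ (leqnn _)); rewrite -/X => Xle.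
  have X0 : 0 <= X by exact: normr_ge0.
  (* With this ratio as [M], the main term of the step count times the step size [A * delta i] is
     [X / 2], which is absorbed on the left; this fixes the slope [(4 * A ^+ 2)^-1]. *)
  have M0 : 0 <= 2 * A * X / delta i.
    by apply: divr_ge0; [rewrite !mulr_ge0//; lra|exact: ltW].
  have := qg j i _ _ M0; rewrite ji ni -/X => /(_ isT) h.
  have {h} : (i - j)%:R <= (4 * A ^+ 2)^-1 * (2 * A * X / delta i) + B.
    apply: h; last by rewrite divfK ?gt_eqF// ler_peMl; lra.
    rewrite mulrAC ler_pdivlMr// -mulrA [_ * delta j]mulrC mulrA.
    rewrite [leRHS](_ : _ = X * (2 * A * delta j)); last by ring.
    by rewrite ler_wpM2l.
  have -> : (4 * A ^+ 2)^-1 * (2 * A * X / delta i) = X / (2 * A * delta i).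
    by field; rewrite !gt_eqF//; lra.
  move=> h; have Am : 0 < A * delta i by rewrite mulr_gt0//; lra.
  have := ler_wpM2l (ltW Am) h; rewrite mulrDr.
  have -> : A * delta i * (X / (2 * A * delta i)) = X / 2.
    by field; rewrite !gt_eqF//; lra.
  by lra.
move=> i; elim/ltn_ind: i => i IHi j /andP[ji ni] dmax.
have m0 := delta0 i ni.
have AB0 : 0 <= A * B * delta i by rewrite !mulr_ge0//; lra.
have [dj|dj] := leP (delta i) (2 * A * delta j).
  by have := direct i j (introT andP (conj ji ni)) dmax dj; lra.
pose P t := (j <= t)%N && (delta i <= 2 * A * delta t).
have exP : exists t, P t.
  by exists i; rewrite /P ji ler_peMl; lra.
case: (ex_minnP exP) => t /andP[jt dt] tmin.
have ti : (t <= i)%N by apply: tmin; rewrite /P ji ler_peMl; lra.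
have tj : (j < t)%N.
  by rewrite ltn_neqAle jt andbT; apply/eqP => jtE; move: dt; rewrite -jtE leNgt dj.
have small l : (j <= l)%N -> (l < t)%N -> 2 * A * delta l < delta i.
  move=> jl lt; rewrite ltNge; apply/negP => h.
  by have := tmin l; rewrite /P jl h leqNgt lt => /(_ isT).
(* The predecessor of [t] is below the threshold and one step multiplies the depth by at most
   [A]. *)
have dt2 : delta t < delta i / 2.
  have t1 : t = t.-1.+1 by rewrite prednK// (leq_ltn_trans _ tj).
  have tn1 : (t.-1 < n)%N by rewrite -t1 (leq_trans ti).
  have := dstep t.-1 tn1; have : 2 * A * delta t.-1 < delta i.
    by apply: small; [rewrite -ltnS -t1|rewrite -t1].
  by rewrite -t1; lra.
have ti' : (t < i)%N.
  by rewrite ltn_neqAle ti andbT; apply/eqP => tiE; move: dt2; rewrite tiE; lra.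
have A0 : 0 < 2 * A by lra.
have h1 : `|w j - w t| <= 4 * A * B * delta t.
  apply: IHi => //; first by rewrite jt (leq_trans ti).
  move=> l /andP[jl]; rewrite leq_eqVlt => /predU1P[->//|lt].
  by rewrite -(ler_pM2l A0); apply: le_trans dt; exact/ltW/small.
have h2 : `|w t - w i| <= 2 * A * B * delta i.
  apply: direct; rewrite ?ti//.
  by move=> l /andP[tl li]; apply: dmax; rewrite li (leq_trans jt).
have h3 : 4 * A * B * delta t <= 4 * A * B * (delta i / 2).
  by rewrite ler_wpM2l ?(ltW dt2)// !mulr_ge0//; lra.
by have := ler_distD (w t) (w j) (w i); lra.
Qed.

(** [p] is an index of maximal depth; [quasigeodesic_cigar] bounds the distance from [w p] to either
    end, using the reversed chain for the end [n]. *)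
Lemma quasigeodesic_depth (A B : R) (w : nat -> E) (delta : nat -> R) (n : nat) :
  1 <= A -> 0 <= B ->
  (forall i, (i <= n)%N -> 0 < delta i) ->
  (forall i, (i < n)%N -> `|w i - w i.+1| <= A * delta i) ->
  (forall i, (i < n)%N -> `|w i - w i.+1| <= A * delta i.+1) ->
  (forall i, (i < n)%N -> delta i.+1 <= A * delta i) ->
  (forall i, (i < n)%N -> delta i <= A * delta i.+1) ->
  (forall i j (M : R), (i <= j <= n)%N -> 0 <= M ->
    `|w i - w j| <= M * delta i -> `|w i - w j| <= M * delta j ->
    (j - i)%:R <= (4 * A ^+ 2)^-1 * M + B) ->
  exists2 p, (p <= n)%N & `|w 0%N - w n| <= 8 * A * B * delta p.
Proof.
move=> A1 B0 delta0 wl wr dl dr qg.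
have [p pmax] : exists p : 'I_n.+1, forall l : 'I_n.+1, delta l <= delta p.
  by case: (@arg_maxP _ _ _ (ord0 : 'I_n.+1) xpredT (fun l => delta l)) => // p _ h;
    exists p => l; exact: h.
have pn : (p <= n)%N by rewrite -ltnS.
have pmax' l : (l <= n)%N -> delta l <= delta p.
  by move=> ln; have := pmax (Ordinal (ln : (l < n.+1)%N)).
exists p => //.
have h1 : `|w 0%N - w p| <= 4 * A * B * delta p.
  apply: (quasigeodesic_cigar A1 B0 delta0 wl dl qg) => // l /andP[_ lp].
  by apply: pmax'; exact: leq_trans pn.
have h2 : `|w n - w p| <= 4 * A * B * delta p.
  have nn i : (i < n)%N -> (n - i = (n - i.+1).+1)%N by move=> ?; rewrite subnSK.
  have lt_n i : (i < n)%N -> (n - i.+1 < n)%N by lia.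
  have := @quasigeodesic_cigar A B (fun i => w (n - i)%N)
    (fun i => delta (n - i)%N) n A1 B0 _ _ _ _ (n - p)%N 0%N.
  rewrite subKn// subn0; apply.
  - by move=> i _; apply: delta0; exact: leq_subr.
  - by move=> i ni; rewrite (nn i ni) distrC; apply: wr; exact: lt_n.
  - by move=> i ni; rewrite (nn i ni); apply: dr; exact: lt_n.
  - move=> i j M /andP[ij jn] M0 h3 h4.
    have -> : (j - i = (n - i) - (n - j))%N by lia.
    by apply: qg; rewrite // 1?distrC//; lia.
  - by rewrite leq_subr.
  - by move=> l _; apply: pmax'; exact: leq_subr.
by have := ler_distD (w p) (w 0%N) (w n); rewrite (distrC (w p)); lra.
Qed.

End quasigeodesic.

(** * Real estimates behind the constants *)

Section real_bounds.
Context {R : realType}.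

(** Taking logarithms, [N] is bounded by a multiple of [ln (1 + c * M)] plus a constant, and [k] by
    a multiple of [N] plus a constant. A logarithm lies below a line of any prescribed slope, so [e]
    can be as small as [quasigeodesic_cigar] demands. *)
Lemma log_sublinear (q Q A c e : R) : 1 < q -> 1 <= Q -> 1 < A -> 1 <= c -> 0 < e ->
  exists2 B, 0 <= B & forall (k N : nat) (M : R), 0 <= M ->
    q ^+ k <= Q * A ^+ N -> q ^+ N <= (Q * (1 + c * M)) ^+ 2 ->
    k%:R <= e * M + B.
Proof.
move=> q1 Q1 A1 c1 e0.
have lq := ln_gt0 q1.
have lA := ln_gt0 A1.
have lQ := ln_ge0 Q1.
pose b := 2 * ln A / ln q ^+ 2.
have b0 : 0 < b by rewrite divr_gt0 ?exprn_gt0//; lra.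
(* Chosen so that the coefficient [b * h * c] of [M] is exactly [e]. *)
pose h := e / (b * c).
have h0 : 0 < h by rewrite divr_gt0// mulr_gt0//; lra.
pose B := ln Q / ln q + b * (ln Q + h - ln h).
exists `|B| => // k N M M0 hk hN.
have cM : 0 < 1 + c * M by rewrite ltr_wpDr// mulr_ge0//; lra.
have l1 : k%:R * ln q <= ln Q + N%:R * ln A.
  move: hk; rewrite -ler_ln ?posrE ?exprn_gt0 ?mulr_gt0 ?exprn_gt0//; [|lra..].
  by rewrite lnM ?posrE ?exprn_gt0 ?lnXn//; [|lra..];
    rewrite -(mulr_natl (ln q)) -(mulr_natl (ln A)).
have l2 : N%:R * ln q <= 2 * (ln Q + ln (1 + c * M)).
  move: hN; rewrite -ler_ln ?posrE ?exprn_gt0 ?mulr_gt0//; [|lra..].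
  by rewrite !lnXn ?mulr_gt0 ?lnM ?posrE//; [|lra..];
    rewrite -(mulr_natl (ln q)) -(mulr_natl (ln Q + _)).
have l3 : ln (1 + c * M) <= h * (1 + c * M) - ln h.
  have hcM : 0 < h * (1 + c * M) by rewrite mulr_gt0.
  have := ltW (ln_sublinear hcM); rewrite lnM ?posrE//; lra.
have l4 : b * (h * (1 + c * M)) = b * h + e * M.
  by rewrite /h; field; rewrite !gt_eqF//; lra.
have l5 : k%:R * ln q <= (e * M + B) * ln q.
  have -> : (e * M + B) * ln q = ln Q + ln q * b * (ln Q + (h * (1 + c * M) - ln h)).
    have -> : ln q * b * (ln Q + (h * (1 + c * M) - ln h)) =
      ln q * (b * (ln Q - ln h) + b * (h * (1 + c * M))) by ring.
    by rewrite l4 /B; field; rewrite gt_eqF.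
  apply: le_trans l1 _; rewrite lerD2l.
  have -> : ln q * b = 2 * ln A / ln q by rewrite /b; field; rewrite gt_eqF.
  rewrite mulrAC ler_pdivlMr// mulrAC.
  have := ler_wpM2r (ltW lA) l2.
  have : 2 * ln A * (ln Q + ln (1 + c * M)) <=
      2 * ln A * (ln Q + (h * (1 + c * M) - ln h)).
    by rewrite ler_wpM2l ?lerD2l ?mulr_ge0 ?(ltW lA)//; lra.
  by lra.
have := l5; rewrite ler_pM2r// => h5; apply: le_trans h5 _.
by rewrite lerD2l ler_norm.
Qed.

(** Only finitely many exponents satisfy the condition; the base [1 + p] makes the powers monotone
    in the exponent. *)
Lemma power_bound (p q Y : R) : 1 < q -> 0 <= p ->
  exists K, forall n : nat, q ^+ n <= Y -> p ^+ n <= K.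
Proof.
move=> q1 p0; have [k hk] := expr_unbounded Y q1.
exists ((1 + p) ^+ k) => n nY.
have nk : (n < k)%N.
  by rewrite ltnNge; apply/negP => kn; have := ler_weXn2l (ltW q1) kn; lra.
apply: (@le_trans _ _ ((1 + p) ^+ n)); first by apply: lerXn2r; rewrite ?nnegrE; lra.
by apply: ler_weXn2l; [lra|exact: ltnW].
Qed.

End real_bounds.

(** * Coarse self-maps and displacement *)

Section chains.
Context {R : realType} {E : normedModType R}.
Variable D : set E.
Local Notation d := (dist_boundary D).

Inductive chain : nat -> E -> E -> Prop :=
| chain_nil u : D u -> chain 0 u u
| chain_cons n u v w : small_step D u v -> chain n v w -> chain n.+1 u w.

Lemma small_step_sym u v : small_step D u v -> small_step D v u.
Proof. by case=> *; split; rewrite // distrC. Qed.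

Lemma chain_rcons n u v w : chain n u v -> small_step D v w -> chain n.+1 u w.
Proof.
elim=> [{}u Du uw|{}n {}u x {}v ux _ IHn vw].
  by apply: (chain_cons uw); apply: chain_nil; case: uw.
by apply: chain_cons ux _; exact: IHn.
Qed.

Lemma chain_sym n u v : chain n u v -> chain n v u.
Proof.
elim=> [{}u Du|{}n {}u x {}v ux _ IHn]; first exact: chain_nil.
by apply: chain_rcons IHn _; exact: small_step_sym.
Qed.

Lemma chain_cat n m u v w : chain n u v -> chain m v w -> chain (n + m) u w.
Proof.
elim=> [{}u _ //|{}n {}u x {}v ux _ IHn /IHn vw].
by rewrite addSn; exact: chain_cons vw.
Qed.

Lemma chain_of_seq (z : nat -> E) n : D (z 0%N) ->
  (forall i, (i < n)%N -> small_step D (z i) (z i.+1)) -> chain n (z 0%N) (z n).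
Proof.
move=> D0; elim: n => [_|n IHn h]; first exact: chain_nil.
by apply: chain_rcons (h n (leqnn _)); apply: IHn => i /leqW; exact: h.
Qed.

Hypotheses (oD : open D) (nDT : D <> setT).

(** Depth is multiplied by at most [A] per step, so the steps sum geometrically; the factor 2
    absorbs the sum. *)
Lemma coarse_lipschitz_chain (A : R) (f : E -> E) n u v : 1 <= A ->
  (forall x, D x -> D (f x)) -> coarse_lipschitz D A f -> chain n u v ->
  d (f v) <= A ^+ n * d (f u) /\ `|f u - f v| <= (2 * A) ^+ n * d (f u).
Proof.
move=> A1 fD cf.
elim=> [{}u Du|{}n {}u x {}v ux _ [IH1 IH2]].
  have := dist_boundary_gt0 oD nDT (fD u Du).
  by rewrite !expr0 !mul1r subrr normr0 => /ltW.
have [h1 h2] := cf _ _ ux.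
have Dx : D x by case: ux.
have An : 0 <= A ^+ n by rewrite exprn_ge0//; lra.
have An2 : 1 <= (2 * A) ^+ n by rewrite exprn_ege1//; lra.
split.
  by rewrite exprSr -mulrA; apply: le_trans IH1 _; rewrite ler_wpM2l.
have := ler_distD (f x) (f u) (f v).
have : (2 * A) ^+ n * d (f x) <= (2 * A) ^+ n * (A * d (f u)).
  by rewrite ler_wpM2l//; lra.
have : 1 * (A * d (f u)) <= (2 * A) ^+ n * (A * d (f u)).
  rewrite ler_wpM2r// mulr_ge0//; first by lra.
  by apply/ltW/dist_boundary_gt0 => //; apply: fD; case: ux.
rewrite [(2 * A) ^+ n.+1]exprS.
by lra.
Qed.

End chains.

Section coarse_self_maps.
Context {R : realType} {E : normedModType R}.
Variables (D : set E) (c A B : R) (K : R -> R).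
Hypotheses (nDT : D <> setT) (c1 : 1 <= c) (A1 : 1 <= A) (B0 : 0 <= B).
Hypothesis uD : uniform_domain c D.
Local Notation d := (dist_boundary D).
Local Notation q := (growth_rate c).
Local Notation Q := (growth_const c).
(** [HB] and [HK] are the conclusions of [log_sublinear] and [power_bound]. As hypotheses they let
    [B] and [K] be fixed before the space and the domain. *)
Hypothesis HB : forall (k N : nat) (M : R), 0 <= M ->
  q ^+ k <= Q * A ^+ N -> q ^+ N <= (Q * (1 + c * M)) ^+ 2 ->
  k%:R <= (4 * A ^+ 2)^-1 * M + B.
Hypothesis HK : forall (M : R) (N : nat),
  q ^+ N <= (Q * (1 + c * M)) ^+ 2 -> (2 * A) ^+ N <= K M.

Let oD : open D. Proof. by case: uD => -[]. Qed.
Let d_gt0 x : D x -> 0 < d x. Proof. exact: dist_boundary_gt0. Qed.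

(** Two rays from [u] and [v] meet at a point of depth at most [1 + c * M] times either initial
    depth; geometric growth bounds the number of steps of each, whence the square. *)
Lemma uniform_chain u v M : D u -> D v -> 0 <= M ->
  `|u - v| <= M * d u -> `|u - v| <= M * d v ->
  exists2 N, chain D N u v & q ^+ N <= (Q * (1 + c * M)) ^+ 2.
Proof.
move=> Du Dv M0 Mu Mv; have c1' := c1.
have Q1 := growth_const_ge1 c1.
have [m [z [n [z' [n' [zn zn']]]]]] := uniform_rays nDT c1 uD Du Dv.
have len a z0 n0 : D a -> `|u - v| <= M * d a ->
    ray D c (c * `|u - v|) a m z0 n0 ->
    chain D n0 a m /\ q ^+ n0 <= Q * (1 + c * M).
  move=> Da Ma [z0E znE zD zstep zgr]; split.
    by rewrite -z0E -znE; apply: chain_of_seq => //; rewrite z0E.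
  have [Dm _ mS] := zD n0 (leqnn _).
  have := zgr 0%N n0; rewrite leq0n leqnn subn0 z0E znE => /(_ isT) h.
  rewrite -(ler_pM2r (d_gt0 Da)); apply: le_trans h _; rewrite -(mulrA Q).
  rewrite ler_wpM2l; [by []|by lra|].
  have := dist_boundary_lip oD nDT m Da; rewrite distrC -znE.
  have : c * `|u - v| <= c * (M * d a) by rewrite ler_wpM2l//; lra.
  by move: mS; lra.
have [ch1 l1] := len u z n Du Mu zn.
have [ch2 l2] := len v z' n' Dv Mv zn'.
exists (n + n')%N; first by apply: chain_cat ch1 _; exact: chain_sym.
rewrite exprD expr2; have q1 := growth_rate_gt1 c1.
by apply: ler_pM => //; rewrite exprn_ge0//; lra.
Qed.

Lemma K_ge1 M : 0 <= M -> 1 <= K M.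
Proof.
move=> M0; have := @HK M 0; rewrite !expr0; apply.
rewrite exprn_ege1// mulr_ege1//; first exact: growth_const_ge1.
by rewrite lerDl mulr_ge0//; move: c1; lra.
Qed.

Lemma coarse_lipschitz_near (h : E -> E) u v M :
  (forall x, D x -> D (h x)) -> coarse_lipschitz D A h ->
  D u -> D v -> 0 <= M -> `|u - v| <= M * d u -> `|u - v| <= M * d v ->
  `|h u - h v| <= K M * d (h u) /\ d (h v) <= K M * d (h u).
Proof.
move=> hD ch Du Dv M0 Mu Mv.
have [N chN NM] := uniform_chain Du Dv M0 Mu Mv.
have [h1 h2] := coarse_lipschitz_chain oD nDT A1 hD ch chN.
have hu := d_gt0 (hD u Du).
have KN := HK NM.
have AN : A ^+ N <= (2 * A) ^+ N.
  by apply: lerXn2r; rewrite ?nnegrE; move: A1; lra.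
split; first by apply: le_trans h2 _; rewrite ler_wpM2r// ltW.
by apply: le_trans h1 _; rewrite ler_wpM2r ?(ltW hu)//; exact: le_trans KN.
Qed.

Variables (f g : E -> E).
Hypotheses (fD : forall x, D x -> D (f x)) (gD : forall x, D x -> D (g x)).
Hypothesis (fK : forall x, D x -> g (f x) = x).
Hypotheses (cf : coarse_lipschitz D A f) (cg : coarse_lipschitz D A g).

(** The image of a ray is quasigeodesic: a chain of [N] steps between two image points is pulled
    back by [g], so the depths on the ray differ by a factor of at most [A ^+ N]. As these grow
    geometrically, the number of ray steps is logarithmic in [M]. *)
Lemma ray_image_depth S u m z n i : ray D c S u m z n -> (i <= n)%N ->
  exists2 p, (p <= i)%N & `|f (z 0%N) - f (z i)| <= 8 * A * B * d (f (z p)).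
Proof.
move=> [z0 zn zD zstep zgr] ni.
have Dz j : (j <= i)%N -> D (z j) by move=> ji; case: (zD j (leq_trans ji ni)).
have st j : (j < i)%N -> small_step D (z j) (z j.+1).
  by move=> ji; apply: zstep; exact: leq_trans ni.
apply: (quasigeodesic_depth (w := fun j => f (z j))
  (delta := fun j => d (f (z j))) A1 B0).
- by move=> j /Dz /fD /d_gt0.
- by move=> j /st /cf[].
- by move=> j /st /small_step_sym /cf[]; rewrite distrC.
- by move=> j /st /cf[].
- by move=> j /st /small_step_sym /cf[].
- move=> j k M /andP[jk ki] M0 Mj Mk.
  have Dj := Dz j (leq_trans jk ki); have Dk := Dz k ki.
  have [N chN NM] := uniform_chain (fD Dj) (fD Dk) M0 Mj Mk.
  apply: (HB M0 _ NM).
  have [h _] := coarse_lipschitz_chain oD nDT A1 gD cg chN.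
  move: h; rewrite !fK// => h.
  have := zgr j k; rewrite jk (leq_trans ki ni) => /(_ isT) h2.
  rewrite -(ler_pM2r (d_gt0 Dj)); apply: le_trans h2 _; rewrite -(mulrA Q).
  by rewrite ler_wpM2l//; have := growth_const_ge1 c1; lra.
Qed.

(** The rays from [u] near [a] and from [x] meet at [m]. If [f m] is near [a], so is [f x].
    Otherwise the image of the ray from [u] leaves the ball of radius [2 * d x] about [a], and
    before or at its exit it contains a deep point. *)
Lemma boundary_ray x a e : D x -> finite_boundary D a ->
  `|a - x| <= 3 * d x -> 0 < e -> e <= d x ->
  (exists u, [/\ D u, `|u - a| < e & `|f u - a| < e]) ->
  `|f x - a| <= (2 + 2 * K (4 * (1 + c))) * d x \/
  exists z, [/\ D z, `|z - a| <= 2 * (1 + c) * d z + e,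
    `|z - a| <= (4 * c + 1) * d x, d x <= 8 * A * B * d (f z) &
    `|f z - a| <= (2 + 2 * A) * d x].
Proof.
move=> Dx ba ax e0 ed [u [Du ua fua]].
have [c1' A1' dx] := And3 c1 A1 (d_gt0 Dx).
have [m [z [n [z' [n' [zn zn']]]]]] := uniform_rays nDT c1 uD Du Dx.
have S4 : c * `|u - x| <= 4 * c * d x.
  have : c * `|u - x| <= c * (4 * d x); last by lra.
  rewrite ler_wpM2l//; first by lra.
  by have := ler_distD a u x; lra.
have [Dm mx mS] : [/\ D m, `|m - x| <= 2 * (1 + c) * d m & `|m - x| <= 4 * c * d x].
  case: zn' => _ <- zD _ _; have [? h1 h2] := zD n' (leqnn _); split => //.
  exact: le_trans S4.
have dm := d_gt0 Dm.
have [near|far] := leP `|f m - a| (2 * d x).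
  (* [|m - x|] is at most [4 * (1 + c)] times both [d m] and [d x]. *)
  left; have M0 : 0 <= 4 * (1 + c) by lra.
  have [||h _] := coarse_lipschitz_near fD cf Dm Dx M0.
  - have : 0 <= (1 + c) * d m by rewrite mulr_ge0 ?(ltW dm)//; lra.
    by move: mx; lra.
  - by move: mS; lra.
  have K1 := K_ge1 M0.
  have h2 : K (4 * (1 + c)) * d (f m) <= K (4 * (1 + c)) * (2 * d x).
    rewrite ler_wpM2l//; first by lra.
    exact: le_trans (dist_boundary_le (f m) ba) near.
  by have := ler_distD (f m) (f x) a; rewrite (distrC (f x) (f m)); lra.
right; case: (zn) => z0 znE zD zstep _.
have exi : exists i, 2 * d x < `|f (z i) - a| by exists n; rewrite znE.
(* [i] is the exit index. The image starts within [e <= d x] of [a], so it has travelled more than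
   [d x]. *)
case: (ex_minnP exi) => i hi imin.
have ni : (i <= n)%N by apply: imin; rewrite znE.
have [p pi dp] := ray_image_depth zn ni.
have pn := leq_trans pi ni.
have [Dp zp1 zp2] := zD p pn.
exists (z p); split => //.
- by have := ler_distD u (z p) a; lra.
- by have := ler_distD u (z p) a; lra.
- have := ler_distD (f (z 0%N)) (f (z i)) a; rewrite z0 (distrC (f (z i)) (f u)).
  by move: dp; rewrite z0; lra.
(* Before [i] the image is still in the ball; at [i] it is one step further, of size at most
   [2 * A * d x], since depth is at most the distance to [a]. *)
- have before j : (j < i)%N -> `|f (z j) - a| <= 2 * d x.
    by move=> ji; rewrite leNgt; apply/negP => /imin; rewrite leqNgt ji.
  have Adx : 0 <= A * d x by rewrite mulr_ge0 ?(ltW dx)//; lra.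
  move: pi; rewrite leq_eqVlt => /predU1P[->|/before]; last by lra.
  case: i {dp} hi imin ni before => [|i] hi imin ni before.
    by move: hi; rewrite z0; lra.
  have [Di _ _] := zD i (ltnW ni).
  have [h _] := cf (zstep i ni).
  have bi := before i (leqnn _).
  have : A * d (f (z i)) <= A * (2 * d x).
    rewrite ler_wpM2l//; first by lra.
    exact: le_trans (dist_boundary_le _ ba) bi.
  have := ler_distD (f (z i)) (f (z i.+1)) a.
  by rewrite (distrC (f (z i.+1)) (f (z i))); lra.
Qed.

End coarse_self_maps.

(** Iterating density from [b] shrinks the distance to [a] by factors between [r1] and [r2]. At the
    first point within [t], the previous distance was at least [t]. *)
Lemma HD_comparable_point {R : realType} {E : normedModType R} (r1 r2 t : R)
    (X : set E) a b : 0 < r1 -> r1 <= r2 -> r2 < 1 -> HD r1 r2 X ->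
  X a -> X b -> 0 < t -> t <= `|b - a| ->
  exists2 x, X x & r1 * t <= `|x - a| <= t.
Proof.
move=> r1_gt0 r12 r2_lt1 hd Xa Xb t0 tb.
have r2V : 1 < r2^-1 by rewrite invf_gt1//; lra.
have [k hk] := expr_unbounded (`|b - a| / t) r2V.
have {hk} : r2 ^+ k * `|b - a| <= t.
  move: hk; rewrite ltr_pdivrMr// exprVn mulrC.
  by rewrite ltr_pdivlMr ?exprn_gt0//; lra.
elim: k b Xb tb => [|k IHk] b Xb tb.
  rewrite expr0 mul1r => bt; exists b => //; rewrite bt andbT.
  by apply: le_trans tb; rewrite ler_piMl//; lra.
move=> hk; have [x [Xx /andP[x1 x2]]] := hd a b Xa Xb.
have [xt|xt] := leP `|x - a| t.
  exists x => //; rewrite xt andbT; apply: le_trans x1.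
  by rewrite ler_wpM2l//; lra.
apply: (IHk x Xx (ltW xt)); apply: le_trans hk.
by rewrite exprSr -mulrA ler_wpM2l// exprn_ge0//; lra.
Qed.

Section displacement.
Context {R : realType} {E : normedModType R}.
Variables (D : set E) (r1 r2 c A B : R) (K : R -> R) (f g : E -> E).
Hypotheses (nDT : D <> setT) (r1_gt0 : 0 < r1) (r1_le_r2 : r1 <= r2) (r2_lt1 : r2 < 1).
Hypotheses (c1 : 1 <= c) (A1 : 1 <= A) (B0 : 0 <= B).
Hypotheses (uD : uniform_domain c D) (hdD : HD_boundary r1 r2 D).
Local Notation d := (dist_boundary D).
Local Notation q := (growth_rate c).
Local Notation Q := (growth_const c).
Hypothesis HB : forall (k N : nat) (M : R), 0 <= M ->
  q ^+ k <= Q * A ^+ N -> q ^+ N <= (Q * (1 + c * M)) ^+ 2 ->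
  k%:R <= (4 * A ^+ 2)^-1 * M + B.
Hypothesis HK : forall (M : R) (N : nat),
  q ^+ N <= (Q * (1 + c * M)) ^+ 2 -> (2 * A) ^+ N <= K M.
Hypotheses (fD : forall x, D x -> D (f x)) (gD : forall x, D x -> D (g x)).
Hypothesis (fK : forall x, D x -> g (f x) = x).
Hypotheses (cf : coarse_lipschitz D A f) (cg : coarse_lipschitz D A g).
Hypothesis approach : forall a e, finite_boundary D a -> 0 < e ->
  exists u, [/\ D u, `|u - a| < e & `|f u - a| < e].

(** [K1] comes from the first alternative of [boundary_ray], [K2] from pulling two deep image points
    back by [g], and [K3] from comparing [f x] with the image of a point whose depth is known to be
    comparable to [d x]. *)
Definition displacement_bound : R :=
  let K1 := K (4 * (1 + c)) in
  let K2 := K (8 * A * B * (5 + 4 * A)) in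
  let K3 := K ((4 * c + 4) *
    (1 + 2 / r1 * (2 * (1 + c) + K2 + 2 * (1 + c) * K2))) in
  5 + 2 * K1 + (2 + 2 * A) * (1 + K3).

(* [f] and [g] are only ever used as coarse Lipschitz inverses of each other.
   Near [a] and near [b] the images of two rays ending near [x] contain points
   of depth comparable to [d x]; pulling a bounded chain between these points
   back by [g] shows that their preimages already have depth about [d x]. *)
Lemma displacement_le x : D x -> `|x - f x| <= displacement_bound * d x.
Proof.
move=> Dx; have oD : open D by case: uD => -[].
have [c1' A1' r10 r2l] := And4 c1 A1 r1_gt0 r2_lt1.
have dx := dist_boundary_gt0 oD nDT Dx.
have [a ba xa] := near_boundary_point oD nDT Dx dx.
have [b0 bb0 db0] := far_boundary_point hdD.2 oD Dx ba.
have [b bb /andP[b1 b2]] :=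
  HD_comparable_point r1_gt0 r1_le_r2 r2_lt1 hdD.1 ba bb0 dx db0.
(* Two errors [e] use up half of the lower bound [r1 * d x] for [|b - a|]. *)
pose e := r1 * d x / 4.
have e0 : 0 < e by rewrite divr_gt0 ?mulr_gt0.
have r1d : r1 * d x <= 1 * d x by rewrite ler_wpM2r ?(ltW dx)//; move: r1_le_r2; lra.
have ed : e <= d x by rewrite /e; lra.
rewrite /displacement_bound.
set K1 := K (4 * (1 + c)); set M2 := 8 * A * B * (5 + 4 * A).
set K2 := K M2; set k := (_ + _ + _ * K2); set M3 := (4 * c + 4) * _.
set K3 := K M3.
have M20 : 0 <= M2 by rewrite !mulr_ge0//; lra.
have K11 : 1 <= K1 by apply: (K_ge1 c1 HK); lra.
have K21 : 1 <= K2 by exact: (K_ge1 c1 HK).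
have k0 : 0 <= k by rewrite !addr_ge0 ?mulr_ge0//; lra.
have rk0 : 0 <= 2 / r1 * k by rewrite mulr_ge0// divr_ge0// ltW.
have M30 : 0 <= M3 by rewrite mulr_ge0//; lra.
have K31 : 1 <= K3 by exact: (K_ge1 c1 HK).
have AK3 : 0 <= (2 + 2 * A) * (1 + K3) * d x.
  by rewrite !mulr_ge0 ?(ltW dx)//; lra.
have [K1d K2d] : 0 <= K1 * d x /\ 0 <= K2 * d x.
  by split; rewrite mulr_ge0 ?(ltW dx)//; lra.
have ax3 : `|a - x| <= 3 * d x by rewrite distrC; lra.
have bx3 : `|b - x| <= 3 * d x by have := ler_distD a b x; rewrite (distrC a x); lra.
have [ha|[z [Dz z1 z2 z3 z4]]] :=
    boundary_ray nDT c1 A1 B0 uD HB HK fD gD fK cf cg Dx ba ax3 e0 ed (approach ba e0).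
  move: ha; rewrite -/K1 => ha.
  by have := ler_distD a x (f x); rewrite (distrC a (f x)); lra.
have [hb|[y [Dy y1 y2 y3 y4]]] :=
    boundary_ray nDT c1 A1 B0 uD HB HK fD gD fK cf cg Dx bb bx3 e0 ed (approach bb e0).
  move: hb; rewrite -/K1 => hb.
  by have := ler_distD b x (f x); rewrite (distrC b (f x)) (distrC x b); lra.
have A5 : 0 <= 5 + 4 * A by lra.
have [Dfz Dfy] := (fD Dz, fD Dy).
have zy : `|f z - f y| <= (5 + 4 * A) * d x.
  have := ler_distD a (f z) (f y); have := ler_distD b a (f y).
  by rewrite (distrC a b) (distrC b (f y)); lra.
have [] := coarse_lipschitz_near nDT c1 A1 uD HK gD cg Dfz Dfy M20.
- apply: le_trans zy _; rewrite /M2 -mulrA mulrCA.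
  by have := ler_wpM2l A5 z3; lra.
- apply: le_trans zy _.
  by have := ler_wpM2l A5 y3; rewrite /M2; lra.
rewrite !fK// -/K2 => gzy dyz.
have dz := dist_boundary_gt0 oD nDT Dz.
(* The path from [a] through [z] and [y] to [b] has length at least [r1 * d x], while
   [d y <= K2 * d z]; so [z] cannot be too shallow. *)
have dkz : r1 * d x <= 2 * k * d z.
  have : 2 * (1 + c) * d y <= 2 * (1 + c) * (K2 * d z) by rewrite ler_wpM2l//; lra.
  have := ler_distD z a b; have := ler_distD y z b.
  by rewrite (distrC a z) (distrC a b) /k; move: z1 y1; rewrite /e; lra.
have dzx : d x <= 2 / r1 * k * d z.
  by rewrite [2 / r1 * k]mulrAC [_ * d z]mulrAC ler_pdivlMr//; lra.
have zx : `|z - x| <= (4 * c + 4) * d x.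
  by have := ler_distD a z x; lra.
have c4 : 0 <= 4 * c + 4 by lra.
have [||h _] := coarse_lipschitz_near nDT c1 A1 uD HK fD cf Dz Dx M30.
- apply: le_trans zx _; rewrite /M3 -[leRHS]mulrA ler_wpM2l//.
  by rewrite mulrDl mul1r; apply: le_trans dzx _; rewrite lerDr ltW.
- apply: le_trans zx _; rewrite /M3 -[leRHS]mulrA ler_wpM2l// ler_peMl ?(ltW dx)//.
  by rewrite lerDl.
have h2 : K3 * d (f z) <= K3 * ((2 + 2 * A) * d x).
  rewrite ler_wpM2l//; first by lra.
  exact: le_trans (dist_boundary_le (f z) ba) z4.
have := ler_distD a x (f x); have := ler_distD (f z) a (f x).
by move: h; rewrite -/K3 (distrC a (f z)); lra.
Qed.

End displacement.

Theorem theorem1p5 (R : realType) (r1 r2 c : R) (phi : R -> R)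
    (r1_gt0 : 0 < r1) (r1_le_r2 : r1 <= r2) (r2_lt1 : r2 < 1)
    (phi_homeo : homeomorphism [set` `[(0 : R), +oo[] [set` `[(0 : R), +oo[] phi)
    (phi_ge : forall t : R, 0 <= t -> t <= phi t) :
  exists C : R,
    forall (E : completeNormedModType R) (D : set E) (f : E -> E),
      dim_ge2 E -> D <> setT -> uniform_domain c D -> HD_boundary r1 r2 D ->
      FQC phi D D f -> identity_boundary_values D f ->
      forall x : E, D x -> (qh_dist D x (f x) <= C%:E)%E.
Proof.
have [psi [phi_cont _ _ _]] := phi_homeo.
have phi_cont01 : {within `[0, 1], continuous phi}.
  by apply: continuous_subspaceW phi_cont => t /=; rewrite !in_itv /= andbT => /andP[].
have [t0 _ phi_max] := EVT_max ler01 phi_cont01.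
(* The ray estimates require a uniformity constant of at least 1. *)
pose c' := Num.max 1 c.
have c1 : 1 <= c' by rewrite le_max lexx.
(* The added 1 in the exponent gives a strict bound for [phi] on [[0, 1]]. *)
pose A := 1 + expR (phi t0 + 1).
have A1 : 1 < A by rewrite ltrDl expR_gt0.
have q1 := growth_rate_gt1 c1.
have e0 : 0 < (4 * A ^+ 2)^-1 by rewrite invr_gt0 mulr_gt0// exprn_gt0//; lra.
have [B B0 HB] := log_sublinear q1 (growth_const_ge1 c1) A1 c1 e0.
have A20 : 0 <= 2 * A by lra.
have [K HK] := choice (fun M : R =>
  power_bound ((growth_const c' * (1 + c' * M)) ^+ 2) q1 A20).
pose M := displacement_bound r1 c' A B K.
exists (c' * (1 + c') * M) => E D f _ nDT uD0 hdD fqc ibv x Dx.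
have uD : uniform_domain c' D.
  by apply: uniform_domain_weaken uD0 => //; rewrite le_max lexx orbT.
have [domD _ [g0 hfg0] fsolid] := fqc.
have oD : open D by case: domD.
(* Identifies the target in the solidity of [f] on the subdomain [D] itself. *)
have imD : f @` D = D.
  case: hfg0 => _ _ h1 h2; apply/seteqP; split=> [_ [y /h1[? _] <-]//|y /h2[Dy fy]].
  by exists (g0 y).
have [_ _] := fsolid D domD (fun _ h => h); rewrite imD.
move=> [g [[_ _ fgD gfD] qf qg]].
have fD y : D y -> D (f y) by move=> /fgD[].
have gD y : D y -> D (g y) by move=> /gfD[].
have fK y : D y -> g (f y) = y by move=> /fgD[].
have gK y : D y -> f (g y) = y by move=> /gfD[].
have phiA t : 0 <= t <= 1 -> phi t < phi t0 + 1.
  by move=> t01; apply: le_lt_trans (phi_max t _) _; rewrite ?in_itv//= ltrDl.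
have cf : coarse_lipschitz D A f by exact: qh_controlled_coarse_lipschitz qf.
have cg : coarse_lipschitz D A g by exact: qh_controlled_coarse_lipschitz qg.
have af a e : finite_boundary D a -> 0 < e ->
  exists u, [/\ D u, `|u - a| < e & `|f u - a| < e] by exact: boundary_approach.
have ag a e : finite_boundary D a -> 0 < e ->
    exists u, [/\ D u, `|u - a| < e & `|g u - a| < e].
  move=> ba e_gt0; have [u [Du ua fua]] := af a e ba e_gt0.
  by exists (f u); rewrite fK//; split => //; exact: fD.
have A1' := ltW A1.
(* The displacement bound for [f] at [x] is relative to [d x]; that for [g] at [f x] is relative to
   [d (f x)]. *)
apply: uniform_qh_dist => //; first exact: fD.
  exact: (displacement_le nDT r1_gt0 r1_le_r2 r2_lt1 c1 A1' B0 uD hdD HB HK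
    fD gD fK cf cg af).
rewrite distrC -{2}(fK x Dx).
exact: (displacement_le nDT r1_gt0 r1_le_r2 r2_lt1 c1 A1' B0 uD hdD HB HK
  gD fD gK cg cf ag (fD x Dx)).
Qed.
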